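(* (i) For every uniformly highly computable sequence $(G_e)_{e\in\mathbb{N}}$ of connected, locally finite multigraphs each of which has exactly one end, the set $\{e\in\mathbb{N} : G_e \text{ admits a one-way infinite Eulerian path}\}$ is $\Sigma_2^{-1}$. (ii) For every $\Sigma_2^{-1}$ set $W\subseteq\mathbb{N}$ there is a uniformly highly computable sequence $(G_e)_{e\in\mathbb{N}}$ of connected, locally finite multigraphs each having exactly one end such that $W=\{e\in\mathbb{N} : G_e \text{ admits a one-way infinite Eulerian path}\}$. In particular, deciding whether a highly computable graph with one end admits a one-way Eulerian path is $\Sigma_2^{-1}$-complete (with respect to many-one reductions).
   Context: Multigraphs are undirected, may have loops and multiple edges; the degree of a vertex is the number of incident edges, loops counted twice. A multigraph $G$ is computable if $V(G)$ is a decidable subset of $\mathbb{N}$ and the function $(u,v)\mapsto$ (number of edges joining $u$ and $v$) is computable; it is highly computable if moreover it is locally finite (every vertex has finite degree) and the degree function $V(G)\to\mathbb{N}$ is computable. A sequence $(G_e)_{e\in\mathbb{N}}$ is uniformly highly computable if there are computable functions $V(e,v)$, $E(e,u,v)$, $\deg(e,v)$ giving, uniformly in $e$, membership in $V(G_e)$, the number of edges joining $u,v$ in $G_e$, and the degree of $v$ in $G_e$. For a connected locally finite multigraph $G$, the number of ends of $G$ is the supremum, over all finite sets $F$ of edges, of the number of infinite connected components of $G\smallsetminus F$ (the multigraph with the edges of $F$ removed). A one-way infinite Eulerian path is a sequence $v_0,v_1,\dots$ of vertices together with edges $e_n$ joining $v_n$ and $v_{n+1}$ such that every edge of $G$ equals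 $e_n$ for exactly one $n\in\mathbb{N}$. A set $A\subseteq\mathbb{N}$ is $\Sigma_2^{-1}$ (2-c.e.) if there is a computable $f:\mathbb{N}^2\to\{0,1\}$ with $f(x,0)=0$... more precisely, with $A(x)=\lim_s f(x,s)$ and $|\{s: f(x,s)\neq f(x,s+1)\}|\le 2$ for all $x$; equivalently $A=A_1\smallsetminus A_2$ for c.e. sets $A_1\supseteq A_2$. *)

(* Defs.v *)
From mathcomp Require Import all_boot.
From mathcomp Require Import boolp classical_sets functions cardinality.
From Stdlib Require Import Relation_Operators.
Set Implicit Arguments.
Unset Strict Implicit.
Unset Printing Implicit Defensive.
Local Open Scope classical_set_scope.
Local Open Scope card_scope.

(* The total recursive functions in Kleene's sense: minimization is applied
   only to regular functions, so every member of the class is total. *)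
Inductive recursive : forall n : nat, (n.-tuple nat -> nat) -> Prop :=
| rec_zero n : recursive (fun _ : n.-tuple nat => 0)
| rec_succ : recursive (fun v : 1.-tuple nat => (thead v).+1)
| rec_proj n (i : 'I_n) : recursive (fun v : n.-tuple nat => tnth v i)
| rec_comp m n (f : m.-tuple nat -> nat) (g : 'I_m -> n.-tuple nat -> nat) :
    recursive f -> (forall i, recursive (g i)) ->
    recursive (fun v : n.-tuple nat => f [tuple g i v | i < m])
| rec_prim n (f : n.-tuple nat -> nat) (g : n.+2.-tuple nat -> nat)
    (h : n.+1.-tuple nat -> nat) :
    recursive f -> recursive g ->
    (forall v : n.-tuple nat, h [tuple of 0 :: v] = f v) ->
    (forall k (v : n.-tuple nat), h [tuple of k.+1 :: v] =
       g [tuple of k :: h [tuple of k :: v] :: v]) ->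
    recursive h
| rec_mu n (f : n.+1.-tuple nat -> nat) (h : n.-tuple nat -> nat) :
    recursive f ->
    (forall v : n.-tuple nat, f [tuple of h v :: v] = 0) ->
    (forall (v : n.-tuple nat) k, k < h v -> f [tuple of k :: v] <> 0) ->
    recursive h
| rec_ext n (f g : n.-tuple nat -> nat) : f =1 g -> recursive f -> recursive g.

Definition computable1 (f : nat -> nat) : Prop :=
  recursive (fun v : 1.-tuple nat => f (nth 0 v 0)).
Definition computable2 (f : nat -> nat -> nat) : Prop :=
  recursive (fun v : 2.-tuple nat => f (nth 0 v 0) (nth 0 v 1)).
Definition computable3 (f : nat -> nat -> nat -> nat) : Prop :=
  recursive (fun v : 3.-tuple nat => f (nth 0 v 0) (nth 0 v 1) (nth 0 v 2)).

(* [mult u v] is the number of edges joining u and v; [mult u u] is the number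
   of loops at u. No computability is assumed of [vert] and [mult]. *)
Record multigraph : Type := Multigraph {
  vert : pred nat;
  mult : nat -> nat -> nat;
  mult_sym : forall u v, mult u v = mult v u;
  mult_vert : forall u v, 0 < mult u v -> vert u
}.

(* (u, v, i) with u <= v stands for the i-th of the edges joining u and v. *)
Definition edge : Type := (nat * nat * nat)%type.

Definition edges (G : multigraph) : set edge :=
  [set x | x.1.1 <= x.1.2 /\ x.2 < mult G x.1.1 x.1.2].

Definition joins (x : edge) (u v : nat) : Prop :=
  x.1 = (u, v) \/ x.1 = (v, u).

(* All neighbours of v lie below N; the final summand makes loops count twice. *)
Definition has_degree (G : multigraph) (v d : nat) : Prop :=
  exists N, (forall w, N <= w -> mult G v w = 0) /\
            d = \sum_(w < N) mult G v w + mult G v v.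

Definition locally_finite (G : multigraph) : Prop :=
  forall v, vert G v -> exists d, has_degree G v d.

Definition adjacent_off (G : multigraph) (F : set edge) (u v : nat) : Prop :=
  exists x, [/\ edges G x, ~ F x & joins x u v].

(* The connected component of v in the multigraph G with the edges F removed. *)
Definition component (G : multigraph) (F : set edge) (v : nat) : set nat :=
  [set w | clos_refl_trans nat (adjacent_off G F) v w].

Definition infinite_components (G : multigraph) (F : set edge) : set (set nat) :=
  [set C | infinite_set C /\ exists2 v, vert G v & C = component G F v].

Definition connected (G : multigraph) : Prop :=
  forall u v, vert G u -> vert G v -> component G set0 u v.

(* The supremum of the numbers of infinite components, over all finite sets of
   edges removed, equals n. *)
Definition number_of_ends (G : multigraph) (n : nat) : Prop :=
  (forall F : set edge, finite_set F -> F `<=` edges G ->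
     infinite_components G F #<= `I_n) /\
  (exists F : set edge, [/\ finite_set F, F `<=` edges G &
     `I_n #<= infinite_components G F]).

Definition one_way_eulerian_path (G : multigraph)
    (v : nat -> nat) (x : nat -> edge) : Prop :=
  (forall n, edges G (x n) /\ joins (x n) (v n) (v n.+1)) /\
  (forall y, edges G y -> exists! n, x n = y).

Definition one_way_eulerian (G : multigraph) : Prop :=
  exists v x, one_way_eulerian_path G v x.

Definition uniformly_highly_computable (G : nat -> multigraph) : Prop :=
  (forall e, locally_finite (G e)) /\
  exists (V : nat -> nat -> nat) (E : nat -> nat -> nat -> nat)
         (deg : nat -> nat -> nat),
    [/\ computable2 V, computable3 E & computable2 deg] /\
    [/\ forall e v, V e v = nat_of_bool (vert (G e) v),
        forall e u v, E e u v = mult (G e) u v &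
        forall e v, vert (G e) v -> has_degree (G e) v (deg e v)].

(* Normalized by f x 0 = 0; without it the class would be larger than that of
   the differences of c.e. sets. *)
Definition Sigma2inv (A : set nat) : Prop :=
  exists f : nat -> nat -> bool,
    [/\ computable2 (fun x s => nat_of_bool (f x s)),
        forall x, f x 0 = false,
        forall x, exists s0, forall s, s0 <= s -> (f x s <-> A x) &
        forall x, [set s | f x s <> f x s.+1] #<= `I_2].

Definition many_one_reducible (A B : set nat) : Prop :=
  exists2 g : nat -> nat, computable1 g & forall x, A x <-> B (g x).

Definition Sigma2inv_complete (A : set nat) : Prop :=
  Sigma2inv A /\ forall B, Sigma2inv B -> many_one_reducible B A.

(* Main.v *)
Require Import Defs.
From mathcomp Require Import all_boot.
From mathcomp Require Import boolp classical_sets functions cardinality.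
From mathcomp Require Import zify.
From Stdlib Require Import Relation_Operators.
Set Implicit Arguments.
Unset Strict Implicit.
Unset Printing Implicit Defensive.
Local Open Scope classical_set_scope.
Local Open Scope card_scope.

(**
A connected locally finite graph with one end has a one-way infinite Eulerian
path iff exactly one vertex has odd degree. Necessity is a parity count. For
sufficiency one extends finite trails T from the odd vertex, keeping the
remaining edges connected to the end of T. To absorb a given edge, continue T by
a trail P through it: by the handshake lemma the component of the end of P is
infinite, so by one-endedness the other components are finite, and with P they
form a finite connected graph having an Eulerian trail with the same ends as P.

Hence (i): "at least one odd vertex" and "at least two odd vertices" are c.e.
For (ii), put 2 - f e n parallel edges between n and n + 1 of a ray: its odd
vertices are the successors of the stages at which f e changes. Completeness
follows from (ii) applied to a universal 2-c.e. set, obtained by enumerating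
finite sets of facts "program c maps x to y" each of which is justified by
others.
*)

(** * Recursive functions *)

(** The class [recursive] contains total functions only and carries no codes, so a universal set
    cannot be had by listing it. Programs, possibly partial, are instead given a meaning by finite
    certificates, and checking a certificate needs bounded quantifiers only.

    On the side of graphs, a trail never comes back to a piece that it has cut off. Finite pieces
    must therefore be absorbed in the same step that would separate them, and connectedness of the
    remaining edges belongs to the invariant. *)

Definition Rec n (F : seq nat -> nat) : Prop :=
  recursive (fun v : n.-tuple nat => F v).

(** Agreement is asked on lists of length [n] only; working with functions on all lists avoids casts
    between tuple types. *)
Lemma Rec_ext n (F G : seq nat -> nat) :
  (forall v : n.-tuple nat, F v = G v) -> Rec n F -> Rec n G.
Proof. by move=> FG; apply: rec_ext. Qed.

Lemma Rec_nth n i : Rec n (fun s => nth 0 s i).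
Proof.
case: (ltnP i n) => [lt_in|le_ni].
  apply: (rec_ext (f := fun v => tnth v (Ordinal lt_in))); last exact: rec_proj.
  by move=> v; rewrite (tnth_nth 0).
apply: rec_ext (rec_zero n) => v.
by rewrite nth_default // size_tuple.
Qed.

Lemma Rec_comp m n (f : seq nat -> nat) (Gs : seq (seq nat -> nat)) :
  size Gs = m -> Rec m f -> (forall i, i < m -> Rec n (nth (fun=> 0) Gs i)) ->
  Rec n (fun s => f [seq G s | G <- Gs]).
Proof.
move=> sz rf rG.
apply: (rec_ext (f := fun v : n.-tuple nat =>
    f [tuple nth (fun=> 0) Gs i v | i < m])); last first.
  exact: (rec_comp (f := fun v : m.-tuple nat => f v)
    (g := fun i v => nth (fun=> 0) Gs i v)) rf (fun i => rG i (ltn_ord i)).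
move=> v; congr f; apply: (@eq_from_nth _ 0).
  by rewrite size_tuple size_map.
rewrite size_tuple => i lt_im.
rewrite -(tnth_nth 0 _ (Ordinal lt_im)) tnth_mktuple /=.
by rewrite (nth_map (fun=> 0)) ?sz.
Qed.

Lemma Rec_app1 n f F : computable1 f -> Rec n F -> Rec n (fun s => f (F s)).
Proof.
move=> cf rF.
by apply: (@Rec_comp 1 n (fun s => f (nth 0 s 0)) [:: F]) => // -[].
Qed.

Lemma Rec_app2 n f F G : computable2 f -> Rec n F -> Rec n G ->
  Rec n (fun s => f (F s) (G s)).
Proof.
move=> cf rF rG.
by apply: (@Rec_comp 2 n (fun s => f (nth 0 s 0) (nth 0 s 1)) [:: F; G])
  => // -[|[]].
Qed.

Lemma Rec_app3 n f F G H : computable3 f -> Rec n F -> Rec n G -> Rec n H ->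
  Rec n (fun s => f (F s) (G s) (H s)).
Proof.
move=> cf rF rG rH.
by apply: (@Rec_comp 3 n
  (fun s => f (nth 0 s 0) (nth 0 s 1) (nth 0 s 2)) [:: F; G; H])
  => // -[|[|[]]].
Qed.

Lemma Rec_prim n f g h : Rec n f -> Rec n.+2 g ->
  (forall v : n.-tuple nat, h (0 :: v) = f v) ->
  (forall k (v : n.-tuple nat), h (k.+1 :: v) = g [:: k, h (k :: v) & v]) ->
  Rec n.+1 h.
Proof. by move=> rf rg h0 hS; exact: (rec_prim rf rg h0 hS). Qed.

Lemma computable1_succ : computable1 succn.
Proof. by apply: rec_ext rec_succ => v; rewrite /thead (tnth_nth 0). Qed.

Lemma Rec_const n k : Rec n (fun=> k).
Proof.
elim: k => [|k IHk]; first exact: rec_zero.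
exact: Rec_app1 computable1_succ IHk.
Qed.

Lemma Rec_tuple1 f : Rec 1 f -> computable1 (fun x => f [:: x]).
Proof.
move=> rf; apply: (@Rec_ext 1 f (fun s => f [:: nth 0 s 0])) => //.
by move=> -[[|x []]].
Qed.

Lemma Rec_tuple2 f : Rec 2 f -> computable2 (fun x y => f [:: x; y]).
Proof.
move=> rf; apply: (@Rec_ext 2 f (fun s => f [:: nth 0 s 0; nth 0 s 1])) => //.
by move=> -[[|x [|y []]]].
Qed.

Lemma Rec_tuple3 f : Rec 3 f -> computable3 (fun x y z => f [:: x; y; z]).
Proof.
move=> rf.
apply: (@Rec_ext 3 f (fun s => f [:: nth 0 s 0; nth 0 s 1; nth 0 s 2])) => //.
by move=> -[[|x [|y [|z []]]]].
Qed.

Lemma computable2_addn : computable2 addn.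
Proof.
apply: (@Rec_prim 1 (fun s => nth 0 s 0) (fun s => (nth 0 s 1).+1)
  (fun s => nth 0 s 0 + nth 0 s 1)) => //.
- exact: Rec_nth.
- exact: Rec_app1 computable1_succ (Rec_nth _ _).
Qed.

Lemma computable2_muln : computable2 muln.
Proof.
apply: (@Rec_prim 1 (fun=> 0) (fun s => nth 0 s 2 + nth 0 s 1)
  (fun s => nth 0 s 0 * nth 0 s 1)) => //.
- exact: Rec_const.
- by apply: Rec_app2 computable2_addn _ _; exact: Rec_nth.
Qed.

Lemma computable1_pred : computable1 predn.
Proof.
apply: (@Rec_prim 0 (fun=> 0) (fun s => nth 0 s 0)
  (fun s => (nth 0 s 0).-1)) => //.
- exact: Rec_const.
- exact: Rec_nth.
Qed.

Lemma computable2_subn : computable2 subn.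
Proof.
(* Primitive recursion runs on the first argument, so the subtrahend comes first and the arguments
   are swapped back at the end. *)
have H : Rec 2 (fun s => nth 0 s 1 - nth 0 s 0).
  apply: (@Rec_prim 1 (fun s => nth 0 s 0) (fun s => (nth 0 s 1).-1)
    (fun s => nth 0 s 1 - nth 0 s 0)) => //.
  - exact: Rec_nth.
  - exact: Rec_app1 computable1_pred (Rec_nth _ _).
  - by move=> v /=; rewrite subn0.
  - by move=> k v /=; rewrite subnS.
exact: (Rec_app2 (Rec_tuple2 H) (Rec_nth 2 1) (Rec_nth 2 0)).
Qed.

Lemma computable1_exp2 : computable1 (expn 2).
Proof.
apply: (@Rec_prim 0 (fun=> 1) (fun s => nth 0 s 1 + nth 0 s 1)
  (fun s => 2 ^ nth 0 s 0)) => //.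
- exact: Rec_const.
- by apply: Rec_app2 computable2_addn _ _; exact: Rec_nth.
- by move=> k v /=; rewrite expnS mul2n addnn.
Qed.

Lemma Rec_negb n (p : seq nat -> bool) : Rec n p -> Rec n (fun s => ~~ p s).
Proof.
move=> rp; apply: (@Rec_ext n (fun s => 1 - p s)); first by move=> v; case: (p v).
exact: Rec_app2 computable2_subn (Rec_const _ _) rp.
Qed.

Lemma Rec_andb n (p q : seq nat -> bool) :
  Rec n p -> Rec n q -> Rec n (fun s => p s && q s).
Proof.
move=> rp rq; apply: (@Rec_ext n (fun s => p s * q s)).
  by move=> v; rewrite mulnb.
exact: Rec_app2 computable2_muln rp rq.
Qed.

Lemma Rec_orb n (p q : seq nat -> bool) :
  Rec n p -> Rec n q -> Rec n (fun s => p s || q s).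
Proof.
move=> rp rq; apply: (@Rec_ext n (fun s => ~~ (~~ p s && ~~ q s))).
  by move=> v; rewrite negb_and !negbK.
by apply/Rec_negb/Rec_andb; apply: Rec_negb.
Qed.

(** * Bounded quantification *)

Definition bex (n : nat) (p : pred nat) : bool := has p (iota 0 n).

Lemma bexP n (p : pred nat) : reflect (exists2 k, k < n & p k) (bex n p).
Proof.
apply: (iffP hasP) => -[k]; last by exists k => //; rewrite mem_iota.
by rewrite mem_iota add0n => lt_kn pk; exists k.
Qed.

Lemma bexS n p : bex n.+1 p = bex n p || p n.
Proof. by rewrite /bex -addn1 iotaD has_cat /= orbF. Qed.

Lemma Rec_bex n (B : seq nat -> nat) (p : seq nat -> bool) :
  Rec n B -> Rec n.+1 p -> Rec n (fun s => bex (B s) (fun k => p (k :: s))).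
Proof.
move=> rB rp.
have rH : Rec n.+1 (fun s => bex (head 0 s) (fun k => p (k :: behead s))).
  (* The step function receives the counter, the value so far and the parameters; [p] must not see
     the value so far. *)
  have rg : Rec n.+2 (fun s => (0 < nth 0 s 1) || p (nth 0 s 0 :: drop 2 s)).
    apply: Rec_orb.
      apply: (@Rec_ext _ (fun s => 1 - (1 - nth 0 s 1))).
        by move=> v; case: (nth 0 v 1) => //= k; rewrite subSS sub0n.
      apply: (Rec_app2 computable2_subn (Rec_const _ _)).
      exact: (Rec_app2 computable2_subn (Rec_const _ _) (Rec_nth _ _)).
    pose Gs := [seq (fun s => nth 0 s i) | i <- 0 :: iota 2 n].
    have szG : size Gs = n.+1 by rewrite /= size_map size_iota.
    apply: (Rec_ext _ (Rec_comp szG rp _)).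
      move=> v; congr (nat_of_bool (p _)).
      apply: (@eq_from_nth _ 0).
        by rewrite size_map szG /= size_drop size_tuple subn2.
      rewrite size_map szG => i ltin.
      rewrite (nth_map (fun=> 0)) ?szG // (nth_map 0) ?size_iota //=;
        last by rewrite size_iota.
      by case: i ltin => //= i ltin; rewrite nth_iota // nth_drop.
    move=> i ltin; rewrite (nth_map 0); last by rewrite /= size_iota.
    exact: Rec_nth.
  apply: (@Rec_prim n (fun=> 0) _ (fun s => bex (head 0 s) _)
    (Rec_const _ _) rg) => // k v /=.
  by rewrite bexS lt0b drop0.
(* Composition substitutes [B s] for the bound and leaves the parameters unchanged. *)
pose Gs := B :: [seq (fun s => nth 0 s i) | i <- iota 0 n].
have szG : size Gs = n.+1 by rewrite /= size_map size_iota.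
apply: (Rec_ext _ (Rec_comp szG rH _)).
  move=> v /=; congr (nat_of_bool (bex _ _)); apply/funext => k.
  congr (p (k :: _)); apply: (@eq_from_nth _ 0).
    by rewrite !size_map size_iota size_tuple.
  rewrite !size_map size_iota => i ltin.
  by rewrite -map_comp (nth_map 0) ?size_iota //= nth_iota.
case=> //= i ltin; rewrite (nth_map 0) ?size_iota //.
exact: Rec_nth.
Qed.

(* A syntax of recursive terms and decidable formulas with de Bruijn variables,
   so that computability of a definition by bounded quantification is obtained
   by evaluating a closed expression. *)
Inductive tm : Type :=
| Var of nat
| Cst of nat
| App1 (f : nat -> nat) of computable1 f & tm
| App2 (f : nat -> nat -> nat) of computable2 f & tm & tm
| App3 (f : nat -> nat -> nat -> nat) of computable3 f & tm & tm & tm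
| Ind of fm
with fm : Type :=
| Rel2 (p : nat -> nat -> bool) of
    computable2 (fun x y => nat_of_bool (p x y)) & tm & tm
| Neg of fm
| And of fm & fm
| Or of fm & fm
| Ex of tm & fm.

Fixpoint evt (t : tm) (s : seq nat) : nat :=
  match t with
  | Var i => nth 0 s i
  | Cst k => k
  | App1 f _ t1 => f (evt t1 s)
  | App2 f _ t1 t2 => f (evt t1 s) (evt t2 s)
  | App3 f _ t1 t2 t3 => f (evt t1 s) (evt t2 s) (evt t3 s)
  | Ind a => evf a s
  end
with evf (a : fm) (s : seq nat) : bool :=
  match a with
  | Rel2 p _ t1 t2 => p (evt t1 s) (evt t2 s)
  | Neg a1 => ~~ evf a1 s
  | And a1 a2 => evf a1 s && evf a2 s
  | Or a1 a2 => evf a1 s || evf a2 s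
  | Ex t1 a1 => bex (evt t1 s) (fun k => evf a1 (k :: s))
  end.

Scheme tm_fm_ind := Induction for tm Sort Prop
with fm_tm_ind := Induction for fm Sort Prop.
Combined Scheme tm_fm_mutind from tm_fm_ind, fm_tm_ind.

Lemma Rec_ev : (forall t n, Rec n (evt t)) /\ (forall a n, Rec n (evf a)).
Proof.
apply: tm_fm_mutind => /=.
- by move=> i n; exact: Rec_nth.
- by move=> k n; exact: Rec_const.
- by move=> f cf t IHt n; exact: Rec_app1.
- by move=> f cf t IHt u IHu n; exact: Rec_app2.
- by move=> f cf t IHt u IHu w IHw n; exact: Rec_app3.
- by move=> a IHa n; exact: IHa.
- by move=> p cp t IHt u IHu n; exact: (Rec_app2 cp).
- by move=> a IHa n; exact: Rec_negb.
- by move=> a IHa b IHb n; exact: Rec_andb.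
- by move=> a IHa b IHb n; exact: Rec_orb.
- by move=> t IHt a IHa n; exact: Rec_bex.
Qed.

Lemma computable1_evt t f : (forall x, evt t [:: x] = f x) -> computable1 f.
Proof.
by move=> /funext <-; exact/Rec_tuple1/Rec_ev.1.
Qed.

Lemma computable2_evt t f :
  (forall x y, evt t [:: x; y] = f x y) -> computable2 f.
Proof.
move=> tf; have -> : f = fun x y => evt t [:: x; y].
  by apply/funext => x; apply/funext => y.
exact/Rec_tuple2/Rec_ev.1.
Qed.

Lemma computable3_evt t f :
  (forall x y z, evt t [:: x; y; z] = f x y z) -> computable3 f.
Proof.
move=> tf; have -> : f = fun x y z => evt t [:: x; y; z].
  by do 3 apply/funext => ?.
exact/Rec_tuple3/Rec_ev.1.
Qed.

Notation AddT := (App2 computable2_addn).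
Notation MulT := (App2 computable2_muln).
Notation SubT := (App2 computable2_subn).
Notation SuccT := (App1 computable1_succ).
Notation Exp2T := (App1 computable1_exp2).

Lemma computable2_ltn : computable2 (fun x y => nat_of_bool (x < y)).
Proof.
apply: (@computable2_evt
  (SubT (Cst 1) (SubT (Cst 1) (SubT (Var 1) (Var 0))))) => x y /=; lia.
Qed.

Lemma computable2_eqn : computable2 (fun x y => nat_of_bool (x == y)).
Proof.
apply: (@computable2_evt (SubT (Cst 1)
  (AddT (SubT (Var 1) (Var 0)) (SubT (Var 0) (Var 1))))) => x y /=; lia.
Qed.

Notation EqF := (Rel2 computable2_eqn).
Notation LtF := (Rel2 computable2_ltn).

(** * Differences of c.e. sets *)

Definition changes (f : nat -> bool) (n : nat) : nat :=
  count (fun k => f k != f k.+1) (iota 0 n).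

Lemma changesS f n : changes f n.+1 = changes f n + (f n != f n.+1).
Proof. by rewrite /changes -[in iota _ _]addn1 iotaD count_cat /= addn0. Qed.

Lemma leq_changes f : {homo changes f : m n / m <= n}.
Proof.
move=> m n /subnKC <-; elim: (n - m) => [|k IHk]; first by rewrite addn0.
by rewrite addnS changesS; lia.
Qed.

Lemma odd_changes f n : odd (changes f n) = f 0 (+) f n.
Proof.
elim: n => [|n IHn]; first by rewrite addbb.
by rewrite changesS oddD IHn; case: (f 0) (f n) (f n.+1) => -[] [].
Qed.

Lemma card_le_IP T m (A : set T) :
  A #<= `I_m <->
  exists2 f : T -> nat, {in A &, injective f} & forall x, A x -> f x < m.
Proof.
split=> [/pcard_leP[f]|[f injf ltf]].
  by exists f; [exact: inj | move=> x Ax; exact: (funS (s := f))].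
rewrite -(card_le_eql (inj_card_eq injf)); apply: subset_card_le.
by move=> _ [x Ax <-]; exact: ltf.
Qed.

Lemma changes_card f m :
  [set s | f s <> f s.+1] #<= `I_m <-> forall n, changes f n <= m.
Proof.
split=> [/card_le_IP[g injg ltg] n|leqm].
  have chgP k : k \in [seq k <- iota 0 n | f k != f k.+1] -> f k <> f k.+1.
    by rewrite mem_filter => /andP[/eqP].
  rewrite /changes -size_filter -(size_iota 0 m) -(size_map g).
  apply: uniq_leq_size.
    rewrite map_inj_in_uniq ?filter_uniq ?iota_uniq // => k l /chgP ck /chgP cl.
    by apply: injg; rewrite inE.
  by move=> _ /mapP[k /chgP ck ->]; rewrite mem_iota; exact: ltg.
have chgS k : f k <> f k.+1 -> changes f k < changes f k.+1.
  by move=> /eqP ck; rewrite changesS ck addn1.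
(* The counter itself is the injection, since it increases strictly at every change. *)
apply/card_le_IP; exists (changes f) => [k l|k ck]; last first.
  exact: leq_trans (chgS _ ck) (leqm _).
rewrite !inE => /chgS ck /chgS cl e.
case: (ltngtP k l) => // lt; have := leq_changes f lt; lia.
Qed.

(** The approximation can turn on only when a first witness of [p] appears, and it is off for good
    once [q] has a witness. The two c.e. sets need not be nested. *)
Lemma Sigma2inv_difference (p q : nat -> nat -> bool) :
  computable2 (fun x t => nat_of_bool (p x t)) ->
  computable2 (fun x t => nat_of_bool (q x t)) ->
  Sigma2inv [set x | (exists t, p x t) /\ ~ exists t, q x t].
Proof.
move=> cp cq.
exists (fun x s => bex s (p x) && ~~ bex s (q x)); split.
- apply: (@computable2_evt (Ind (And (Ex (Var 1) (Rel2 cp (Var 1) (Var 0)))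
    (Neg (Ex (Var 1) (Rel2 cq (Var 1) (Var 0))))))) => //.
- by [].
- move=> x; case: (EM (exists t, q x t)) => [[t qt]|nq].
    exists t.+1 => s lts; split=> [/andP[_ /bexP[]]|[_ []]]; last by exists t.
    by exists t.
  case: (EM (exists t, p x t)) => [[t pt]|np].
    exists t.+1 => s lts; split=> [_|_]; first by split => //; exists t.
    apply/andP; split; first by apply/bexP; exists t.
    by apply/bexP => -[u _ qu]; apply: nq; exists u.
  exists 0 => s _; split=> [/andP[/bexP[t _ pt] _]|[]//].
  by case: np; exists t.
- move=> x; apply/changes_card => n; set f := (f in changes f n).
  (* Each change is paid for by one of the two searches succeeding. *)
  suff: changes f n <= bex n (p x) + bex n (q x).
    by case: bex (bex n (q x)) => -[]; lia.
  elim: n => // n IHn; rewrite changesS /f !bexS.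
  move: IHn; rewrite -/f; move: (changes f n) => c.
  by case: (bex n (p x)) (bex n (q x)) (p x n) (q x n) => -[] [] [] /=; lia.
Qed.

(** Since [f x] starts at false, a rise followed by a fall uses up both changes. Both conditions on
    the right are witnessed by finitely many values of [f x], hence by a finite certificate. *)
Lemma Sigma2inv_rise_fall (f : nat -> nat -> bool) (A : set nat) :
  (forall x, f x 0 = false) ->
  (forall x, exists s0, forall s, s0 <= s -> (f x s <-> A x)) ->
  (forall x, [set s | f x s <> f x s.+1] #<= `I_2) ->
  forall x, A x <-> (exists s, f x s) /\
                    ~ (exists s t, [/\ s < t, f x s & ~~ f x t]).
Proof.
move=> f0 flim fchg x; have [s0 Hs0] := flim x.
have /changes_card chg2 := fchg x.
have ochg n : odd (changes (f x) n) = f x n by rewrite odd_changes f0.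
split=> [Ax|[[s fs] nst]].
  split; first by exists s0; apply/Hs0.
  move=> [s [t [lt_st fs ft]]].
  have fu : f x (maxn t s0) by apply/Hs0 => //; rewrite leq_maxr.
  (* The counts at [s], [t] and [maxn t s0] are nondecreasing and odd, even, odd, so the last one is
     at least 3. *)
  have := leq_changes (f x) (ltnW lt_st).
  have := leq_changes (f x) (leq_maxl t s0).
  have := chg2 (maxn t s0); have := ochg s; have := ochg t.
  have := ochg (maxn t s0); rewrite fu fs (negbTE ft).
  move: (changes _ _) (changes _ _) (changes _ _) => a b c; lia.
apply/(Hs0 (maxn s.+1 s0)); first by rewrite leq_maxr.
apply: contraT => nf; case: nst; exists s, (maxn s.+1 s0); split=> //.
exact: leq_maxl.
Qed.

(** * A universal 2-c.e. set *)

(** A polynomial pairing, injective but not onto. Its components are bounded by the code, which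
    supplies the bounds of all later quantifiers over components. *)
Definition pr (x y : nat) : nat := (x + y) * (x + y) + x.

Lemma pr_inj x y x' y' : pr x y = pr x' y' -> x = x' /\ y = y'.
Proof.
(* The summand [x] is smaller than the gap between the squares of [x + y] and [x + y + 1]. *)
rewrite /pr => e; have [lt|lt|eq_s] := ltngtP (x + y) (x' + y'); [nia|nia|].
move: e; rewrite eq_s; lia.
Qed.

Lemma leq_prl x y : x <= pr x y. Proof. exact: leq_addl. Qed.

Lemma leq_prr x y : y <= pr x y. Proof. rewrite /pr; nia. Qed.

Lemma computable2_pr : computable2 pr.
Proof.
exact: (@computable2_evt
  (AddT (MulT (AddT (Var 0) (Var 1)) (AddT (Var 0) (Var 1))) (Var 0))).
Qed.

Notation PrT := (App2 computable2_pr).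

(* Finite sets of natural numbers are coded by the binary digits of a number. *)
Definition bit (D n : nat) : bool := odd (D %/ 2 ^ n).

Lemma bit_lt D n : bit D n -> n < D.
Proof.
rewrite /bit; case: (ltnP D (2 ^ n)) => [lt|le _]; first by rewrite divn_small.
exact: leq_trans (ltn_expl n _) le.
Qed.

(** The digit is one iff [D = (2 * a + 1) * 2 ^ n + r] for some [a] and some [r < 2 ^ n], both at
    most [D]. *)
Lemma computable2_bit : computable2 (fun D n => nat_of_bool (bit D n)).
Proof.
apply: (@computable2_evt (Ind (Ex (SuccT (Var 0)) (Ex (SuccT (Var 1))
  (And (EqF (Var 2) (AddT (MulT (SuccT (AddT (Var 1) (Var 1)))
                                (Exp2T (Var 3))) (Var 0)))
       (LtF (Var 0) (Exp2T (Var 3)))))))) => D n /=.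
congr (nat_of_bool _); rewrite /bit; have e0 : 0 < 2 ^ n by rewrite expn_gt0.
apply/idP/idP => [/bexP[a _ /bexP[r _ /andP[/eqP-> lt_r]]]|oddD].
  by rewrite divnMDl // divn_small // addn0 /= oddD addbb.
apply/bexP; exists (D %/ 2 ^ n)./2.
  by rewrite ltnS; have := leq_div D (2 ^ n); lia.
apply/bexP; exists (D %% 2 ^ n); first by rewrite ltnS leq_mod.
rewrite ltn_mod e0 andbT; apply/eqP.
by rewrite {1}(divn_eq D (2 ^ n)) addnn -[in LHS](odd_double_half (D %/ 2 ^ n)) oddD.
Qed.

Notation BitF := (Rel2 computable2_bit).

Lemma bit_exists N (p : pred nat) : exists D, forall n, bit D n = (n < N) && p n.
Proof.
elim: N p => [|N IHN] p; first by exists 0 => n; rewrite /bit div0n.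
have [D HD] := IHN (fun n => p n.+1); exists (p 0 + D.*2) => -[|n].
  by rewrite /bit divn1 oddD odd_double addbF oddb.
rewrite ltnS -HD /bit expnS divnMA divn2; congr (odd (_ %/ _)).
by rewrite half_bit_double.
Qed.

(** * Programs and certificates of their values *)

Definition fact (c x y : nat) : nat := pr c (pr x y).

Lemma fact_inj c x y c' x' y' :
  fact c x y = fact c' x' y' -> [/\ c = c', x = x' & y = y'].
Proof. by move=> /pr_inj[-> /pr_inj[]]. Qed.

(* The facts in D entail in one step that the program c maps x to y. The tags
   0, ..., 7 stand for zero, successor, head, tail, pairing, composition,
   primitive recursion and minimization. *)
Inductive just (D c x y : nat) : Prop :=
| just_zero of c = pr 0 0 & y = 0
| just_succ a l of c = pr 1 0 & x = pr a l & y = a.+1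
| just_head a l of c = pr 2 0 & x = pr a l & y = a
| just_tail a l of c = pr 3 0 & x = pr a l & y = l
| just_cons f g y1 y2 of c = pr 4 (pr f g) & y = pr y1 y2 &
    bit D (fact f x y1) & bit D (fact g x y2)
| just_comp f g z of c = pr 5 (pr f g) &
    bit D (fact g x z) & bit D (fact f z y)
| just_prim0 f g v of c = pr 6 (pr f g) & x = pr 0 v & bit D (fact f v y)
| just_primS f g k v z of c = pr 6 (pr f g) & x = pr k.+1 v &
    bit D (fact c (pr k v) z) & bit D (fact g (pr k (pr z v)) y)
| just_mu f of c = pr 7 f & bit D (fact f (pr y x) 0) &
    (forall k, k < y -> exists z, bit D (fact f (pr k x) z.+1)).

(** The decidable form of [just]. Most witnesses are components of [n]; the intermediate value [z]
    is not, but it occurs in a fact of [D] and so lies below [D]. *)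
Definition justb (D n : nat) : bool :=
  bex n.+1 (fun c => bex n.+1 (fun x => bex n.+1 (fun y => (n == fact c x y) &&
  [|| (c == pr 0 0) && (y == 0),
      bex n.+1 (fun a => bex n.+1 (fun l => (x == pr a l) &&
        [|| (c == pr 1 0) && (y == a.+1),
            (c == pr 2 0) && (y == a) | (c == pr 3 0) && (y == l)])),
      bex n.+1 (fun f => bex n.+1 (fun g =>
        [|| (c == pr 4 (pr f g)) && bex n.+1 (fun y1 => bex n.+1 (fun y2 =>
               (y == pr y1 y2) && (bit D (fact f x y1) && bit D (fact g x y2)))),
            (c == pr 5 (pr f g)) && bex D (fun z =>
               bit D (fact g x z) && bit D (fact f z y)),
            (c == pr 6 (pr f g)) && bex n.+1 (fun v =>
               (x == pr 0 v) && bit D (fact f v y)) |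
            (c == pr 6 (pr f g)) && bex n.+1 (fun k => bex n.+1 (fun v =>
               (x == pr k.+1 v) && bex D (fun z => bit D (fact c (pr k v) z) &&
                 bit D (fact g (pr k (pr z v)) y))))])) |
      bex n.+1 (fun f => (c == pr 7 f) && (bit D (fact f (pr y x) 0) &&
        ~~ bex y (fun k => ~~ bex D (fun z =>
          bit D (fact f (pr k x) z.+1)))))]))).

Definition FactT c x y := PrT c (PrT x y).

(** The term copies the body of [justb]. Under the three outer quantifiers the variables 0 to 4 are
    [y], [x], [c], [D] and [n]. *)
Lemma computable2_justb : computable2 (fun D n => nat_of_bool (justb D n)).
Proof.
exact: (@computable2_evt (Ind
  (Ex (SuccT (Var 1)) (Ex (SuccT (Var 2)) (Ex (SuccT (Var 3))
  (And (EqF (Var 4) (FactT (Var 2) (Var 1) (Var 0)))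
  (Or (And (EqF (Var 2) (PrT (Cst 0) (Cst 0))) (EqF (Var 0) (Cst 0)))
  (Or (Ex (SuccT (Var 4)) (Ex (SuccT (Var 5))
         (And (EqF (Var 3) (PrT (Var 1) (Var 0)))
         (Or (And (EqF (Var 4) (PrT (Cst 1) (Cst 0)))
                  (EqF (Var 2) (SuccT (Var 1))))
         (Or (And (EqF (Var 4) (PrT (Cst 2) (Cst 0))) (EqF (Var 2) (Var 1)))
             (And (EqF (Var 4) (PrT (Cst 3) (Cst 0)))
                  (EqF (Var 2) (Var 0))))))))
  (Or (Ex (SuccT (Var 4)) (Ex (SuccT (Var 5))
         (Or (And (EqF (Var 4) (PrT (Cst 4) (PrT (Var 1) (Var 0))))
                  (Ex (SuccT (Var 6)) (Ex (SuccT (Var 7))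
                    (And (EqF (Var 4) (PrT (Var 1) (Var 0)))
                    (And (BitF (Var 7) (FactT (Var 3) (Var 5) (Var 1)))
                         (BitF (Var 7) (FactT (Var 2) (Var 5) (Var 0))))))))
         (Or (And (EqF (Var 4) (PrT (Cst 5) (PrT (Var 1) (Var 0))))
                  (Ex (Var 5)
                    (And (BitF (Var 6) (FactT (Var 1) (Var 4) (Var 0)))
                         (BitF (Var 6) (FactT (Var 2) (Var 0) (Var 3))))))
         (Or (And (EqF (Var 4) (PrT (Cst 6) (PrT (Var 1) (Var 0))))
                  (Ex (SuccT (Var 6))
                    (And (EqF (Var 4) (PrT (Cst 0) (Var 0)))
                         (BitF (Var 6) (FactT (Var 2) (Var 0) (Var 3))))))
             (And (EqF (Var 4) (PrT (Cst 6) (PrT (Var 1) (Var 0))))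
                  (Ex (SuccT (Var 6)) (Ex (SuccT (Var 7))
                    (And (EqF (Var 5) (PrT (SuccT (Var 1)) (Var 0)))
                    (Ex (Var 7)
                      (And (BitF (Var 8)
                              (FactT (Var 7) (PrT (Var 2) (Var 1)) (Var 0)))
                           (BitF (Var 8)
                              (FactT (Var 3)
                                (PrT (Var 2) (PrT (Var 0) (Var 1)))
                                (Var 5))))))))))))))
      (Ex (SuccT (Var 4)) (And (EqF (Var 3) (PrT (Cst 7) (Var 0)))
         (And (BitF (Var 4) (FactT (Var 0) (PrT (Var 1) (Var 2)) (Cst 0)))
              (Neg (Ex (Var 1) (Neg (Ex (Var 5)
                (BitF (Var 6) (FactT (Var 2) (PrT (Var 1) (Var 4))
                                 (SuccT (Var 0)))))))))))))))))))).
Qed.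

Lemma leq_fact1 c x y : c <= fact c x y. Proof. exact: leq_prl. Qed.

Lemma leq_fact2 c x y : x <= fact c x y.
Proof. exact: leq_trans (leq_prl _ _) (leq_prr _ _). Qed.

Lemma leq_fact3 c x y : y <= fact c x y.
Proof. exact: leq_trans (leq_prr _ _) (leq_prr _ _). Qed.

Lemma just_justb D c x y : just D c x y -> justb D (fact c x y).
Proof.
move=> J; set n := fact c x y.
have [lc lx ly] : [/\ c < n.+1, x < n.+1 & y < n.+1].
  by split; rewrite ltnS; [exact: leq_fact1|exact: leq_fact2|exact: leq_fact3].
have prn a b m : m = pr a b -> m < n.+1 -> a < n.+1 /\ b < n.+1.
  move=> -> lt; split; apply: leq_ltn_trans lt; [exact: leq_prl|exact: leq_prr].
have ltD f u v : bit D (fact f u v) -> v < D.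
  by move=> /bit_lt; apply: leq_ltn_trans; exact: leq_fact3.
apply/bexP; exists c => //; apply/bexP; exists x => //; apply/bexP.
exists y => //; rewrite eqxx /=.
case: J => [ec ey|a l ec ex ey|a l ec ex ey|a l ec ex ey|f g y1 y2 ec ey d1 d2|
  f g z ec d1 d2|f g v ec ex d1|f g k v z ec ex d1 d2|f ec d1 d2].
- by rewrite ec ey !eqxx.
- have [la ll] := prn _ _ _ ex lx; apply/or4P/Or42/bexP; exists a => //.
  by apply/bexP; exists l; rewrite // ex ec ey !eqxx.
- have [la ll] := prn _ _ _ ex lx; apply/or4P/Or42/bexP; exists a => //.
  by apply/bexP; exists l; rewrite // ex ec ey !eqxx !orbT.
- have [la ll] := prn _ _ _ ex lx; apply/or4P/Or42/bexP; exists a => //.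
  by apply/bexP; exists l; rewrite // ex ec ey !eqxx !orbT.
- have [_ lfg] := prn _ _ _ ec lc; have [lf lg] := prn _ _ _ erefl lfg.
  have [ly1 ly2] := prn _ _ _ ey ly.
  apply/or4P/Or43/bexP; exists f => //; apply/bexP; exists g => //.
  apply/or4P/Or41; rewrite ec eqxx; apply/bexP; exists y1 => //.
  by apply/bexP; exists y2; rewrite // ey eqxx d1 d2.
- have [_ lfg] := prn _ _ _ ec lc; have [lf lg] := prn _ _ _ erefl lfg.
  apply/or4P/Or43/bexP; exists f => //; apply/bexP; exists g => //.
  apply/or4P/Or42; rewrite ec eqxx; apply/bexP; exists z; first exact: ltD d1.
  by rewrite d1 d2.
- have [_ lfg] := prn _ _ _ ec lc; have [lf lg] := prn _ _ _ erefl lfg.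
  have [_ lv] := prn _ _ _ ex lx.
  apply/or4P/Or43/bexP; exists f => //; apply/bexP; exists g => //.
  by apply/or4P/Or43; rewrite ec eqxx; apply/bexP; exists v; rewrite // ex eqxx.
- have [_ lfg] := prn _ _ _ ec lc; have [lf lg] := prn _ _ _ erefl lfg.
  have [/ltnW lk lv] := prn _ _ _ ex lx.
  apply/or4P/Or43/bexP; exists f => //; apply/bexP; exists g => //.
  apply/or4P/Or44; rewrite {1}ec eqxx; apply/bexP; exists k => //.
  apply/bexP; exists v; rewrite // ex eqxx; apply/bexP.
  by exists z; [exact: ltD d1|rewrite d1 d2].
- have [_ lf] := prn _ _ _ ec lc.
  apply/or4P/Or44/bexP; exists f; rewrite // ec eqxx d1 /=; apply/bexP => -[k lk].
  by have [z dz] := d2 k lk; case/bexP; exists z => //; exact/ltnW/ltD/dz.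
Qed.

Lemma justbP D n :
  reflect (exists c x y, n = fact c x y /\ just D c x y) (justb D n).
Proof.
apply: (iffP idP) => [/bexP[c _ /bexP[x _ /bexP[y _ /andP[/eqP en J]]]]|
                      [c [x [y [-> J]]]]]; last exact: just_justb.
exists c, x, y; split=> //; move: J.
case/or4P => [/andP[/eqP ec /eqP ey]|/bexP[a _ /bexP[l _ /andP[/eqP ex J]]]|
  /bexP[f _ /bexP[g _ J]]|/bexP[f _ /and3P[/eqP ec d1 /bexP d2]]].
- exact: just_zero.
- case/or3P: J => /andP[/eqP ec /eqP ey];
    [exact: just_succ ex ey|exact: just_head ex ey|exact: just_tail ex ey].
- case/or4P: J => /andP[/eqP ec /bexP].
  + by move=> [y1 _ /bexP[y2 _ /and3P[/eqP]]]; exact: just_cons.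
  + by move=> [z _ /andP[]]; exact: just_comp.
  + by move=> [v _ /andP[/eqP ex d]]; exact: just_prim0 ec ex d.
  + move=> [k _ /bexP[v _ /andP[/eqP ex /bexP[z _ /andP[d1 d2]]]]].
    exact: just_primS ec ex d1 d2.
- apply: (just_mu ec d1) => k lk; apply: contrapT => nz; apply: d2.
  by exists k => //; apply/bexP => -[z _ dz]; apply: nz; exists z.
Qed.

(** Facts occur only positively, even for minimization, where a nonzero value is certified by a fact
    with a successor as value. *)
Lemma just_mono D D' c x y :
  (forall n, bit D n -> bit D' n) -> just D c x y -> just D' c x y.
Proof.
move=> DD'; case.
- exact: just_zero.
- exact: just_succ.
- exact: just_head.
- exact: just_tail.
- by move=> f g y1 y2 ec ey /DD' d1 /DD' d2; exact: just_cons ec ey d1 d2.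
- by move=> f g z ec /DD' d1 /DD' d2; exact: just_comp ec d1 d2.
- by move=> f g v ec ex /DD' d1; exact: just_prim0 ec ex d1.
- by move=> f g k v z ec ex /DD' d1 /DD' d2; exact: just_primS ec ex d1 d2.
- move=> f ec /DD' d1 d2; apply: (just_mu ec d1) => k /d2[z /DD']; by exists z.
Qed.

(* No well-foundedness is required: a fact about a total program can only be
   justified, directly or not, by correct facts. *)
Definition valid (D : nat) : bool := ~~ bex D (fun n => bit D n && ~~ justb D n).

Lemma validP D : reflect (forall n, bit D n -> justb D n) (valid D).
Proof.
apply: (iffP idP) => [/bexP H n Dn|H].
  by apply: contraT => nj; case: H; exists n; [exact: bit_lt|rewrite Dn].
by apply/bexP => -[n _ /andP[/H ->]].
Qed.

Lemma computable2_valid : computable2 (fun D _ => nat_of_bool (valid D)).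
Proof.
exact: (@computable2_evt (Ind (Neg (Ex (Var 0) (And (BitF (Var 1) (Var 0))
  (Neg (Rel2 computable2_justb (Var 1) (Var 0)))))))).
Qed.

Lemma valid_just D c x y : valid D -> bit D (fact c x y) -> just D c x y.
Proof.
by move=> /validP vD /vD /justbP[c' [x' [y' [/fact_inj[-> -> ->]]]]].
Qed.

Lemma valid_union D D' : valid D -> valid D' ->
  exists2 E, valid E & forall n, bit E n = bit D n || bit D' n.
Proof.
move=> vD vD'.
have [E HE] := bit_exists (D + D') (fun n => bit D n || bit D' n).
have {}HE n : bit E n = bit D n || bit D' n.
  rewrite HE; case: (ltnP n (D + D')) => // le; apply/esym/norP.
  by split; apply/negP => /bit_lt; lia.
exists E => //; apply/validP => n; rewrite HE => /orP[].
  move/validP: vD => /[apply] /justbP[c [x [y [-> J]]]].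
  by apply/just_justb/(just_mono _ J) => m Dm; rewrite HE Dm.
move/validP: vD' => /[apply] /justbP[c [x [y [-> J]]]].
by apply/just_justb/(just_mono _ J) => m Dm; rewrite HE Dm orbT.
Qed.

Definition derivable (c x y : nat) : Prop :=
  exists2 D, valid D & bit D (fact c x y).

Lemma derivable_just D c x y : valid D -> just D c x y -> derivable c x y.
Proof.
move=> vD J.
have [E HE] := bit_exists (D + fact c x y).+1
  (fun n => bit D n || (n == fact c x y)).
have {}HE n : bit E n = bit D n || (n == fact c x y).
  rewrite HE; case: (ltnP n (D + fact c x y).+1) => // le.
  by apply/esym/norP; split; [apply/negP => /bit_lt|]; lia.
have sDE m : bit D m -> bit E m by rewrite HE => ->.
exists E; last by rewrite HE eqxx orbT.
apply/validP => n; rewrite HE => /orP[Dn|/eqP->].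
  move/validP: vD => /(_ n Dn) /justbP[c' [x' [y' [-> J']]]].
  exact/just_justb/(just_mono sDE J').
exact/just_justb/(just_mono sDE J).
Qed.

Lemma valid0 : valid 0. Proof. by []. Qed.

Lemma derivable2 c x y c' x' y' : derivable c x y -> derivable c' x' y' ->
  exists2 D, valid D & bit D (fact c x y) /\ bit D (fact c' x' y').
Proof.
move=> [D vD d] [D' vD' d']; have [E vE HE] := valid_union vD vD'.
by exists E => //; rewrite !HE d d' orbT.
Qed.

(** Existence and uniqueness are carried together: the clause that justifies a fact has facts about
    subprograms, or about the same program at a smaller recursion argument, as premises, and their
    uniqueness determines the value. *)
Definition computes (c x y : nat) : Prop :=
  derivable c x y /\
  forall D y', valid D -> bit D (fact c x y') -> y' = y.

(** Discards the clauses of [just] excluded by the tag of the program, or by zero against successor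
    in the recursion argument. *)
Ltac tag_mismatch := by move=> *; match goal with
  e : pr _ _ = pr _ _ |- _ => by case: (pr_inj e) end.

Lemma computes_zero x : computes (pr 0 0) x 0.
Proof.
split; first by apply: (derivable_just valid0); exact: just_zero.
by move=> D y vD /(valid_just vD) []; try tag_mismatch.
Qed.

Lemma computes_succ a l : computes (pr 1 0) (pr a l) a.+1.
Proof.
split; first by apply: (derivable_just valid0); exact: (just_succ _ erefl erefl erefl).
move=> D y vD /(valid_just vD) []; try tag_mismatch.
by move=> a' l' _ /pr_inj[-> _].
Qed.

Lemma computes_head a l : computes (pr 2 0) (pr a l) a.
Proof.
split; first by apply: (derivable_just valid0); exact: (just_head _ erefl erefl erefl).
move=> D y vD /(valid_just vD) []; try tag_mismatch.
by move=> a' l' _ /pr_inj[-> _].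
Qed.

Lemma computes_tail a l : computes (pr 3 0) (pr a l) l.
Proof.
split; first by apply: (derivable_just valid0); exact: (just_tail _ erefl erefl erefl).
move=> D y vD /(valid_just vD) []; try tag_mismatch.
by move=> a' l' _ /pr_inj[_ ->].
Qed.

Lemma computes_cons f g x y1 y2 : computes f x y1 -> computes g x y2 ->
  computes (pr 4 (pr f g)) x (pr y1 y2).
Proof.
move=> [df uf] [dg ug]; split.
  by have [D vD [d1 d2]] := derivable2 df dg;
     apply: (derivable_just vD); exact: just_cons erefl erefl d1 d2.
move=> D y vD /(valid_just vD) []; try tag_mismatch.
move=> f' g' z1 z2 /pr_inj[_ /pr_inj[<- <-]] ->.
by move=> /(uf _ _ vD)-> /(ug _ _ vD)->.
Qed.

Lemma computes_comp f g x z y : computes g x z -> computes f z y ->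
  computes (pr 5 (pr f g)) x y.
Proof.
move=> [dg ug] [df uf]; split.
  by have [D vD [d1 d2]] := derivable2 dg df;
     apply: (derivable_just vD); exact: just_comp erefl d1 d2.
move=> D y' vD /(valid_just vD) []; try tag_mismatch.
move=> f' g' z' /pr_inj[_ /pr_inj[<- <-]].
by move=> /(ug _ _ vD)-> /(uf _ _ vD)->.
Qed.

Lemma computes_prim0 f g v y : computes f v y ->
  computes (pr 6 (pr f g)) (pr 0 v) y.
Proof.
move=> [[D vD df] uf]; split.
  by apply: (derivable_just vD); exact: just_prim0 erefl erefl df.
move=> {vD df}D y' vD /(valid_just vD) []; try tag_mismatch.
by move=> f' g' v' /pr_inj[_ /pr_inj[<- _]] /pr_inj[_ <-] /(uf _ _ vD).
Qed.

Lemma computes_primS f g k v z y : computes (pr 6 (pr f g)) (pr k v) z ->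
  computes g (pr k (pr z v)) y -> computes (pr 6 (pr f g)) (pr k.+1 v) y.
Proof.
move=> [dk uk] [dg ug]; split.
  by have [D vD [d1 d2]] := derivable2 dk dg;
     apply: (derivable_just vD); exact: just_primS erefl erefl d1 d2.
move=> D y' vD /(valid_just vD) []; try tag_mismatch.
move=> f' g' k' v' z' /pr_inj[_ /pr_inj[_ <-]] /pr_inj[[<-] <-].
by move=> /(uk _ _ vD)-> /(ug _ _ vD).
Qed.

Lemma computes_mu f (F : nat -> nat) x y :
  (forall k, computes f (pr k x) (F k)) -> F y = 0 ->
  (forall k, k < y -> F k <> 0) -> computes (pr 7 f) x y.
Proof.
move=> cF Fy0 Flt; split.
  (* One certificate must contain the values at all [k <= y], so the separate ones are united. *)
  have [D vD HD] : exists2 D, valid D &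
      forall k, k < y.+1 -> bit D (fact f (pr k x) (F k)).
    elim: y.+1 => [|n [D vD HD]]; first by exists 0.
    have [[D' vD' d'] _] := cF n; have [E vE HE] := valid_union vD vD'.
    exists E => // k; rewrite ltnS leq_eqVlt HE => /predU1P[->|/HD->//].
    by rewrite d' orbT.
  apply: (derivable_just vD); apply: (just_mu erefl).
    by rewrite -Fy0; exact: HD.
  move=> k lt_ky; exists (F k).-1; have /eqP := Flt k lt_ky.
  by rewrite -lt0n => /prednK->; apply: HD; exact: ltnW.
move=> D y' vD /(valid_just vD) []; try tag_mismatch.
move=> f' /pr_inj[_ <-] d0 dS; have /(cF _).2-/(_ vD) F0 := d0.
(* A smaller [y'] would be an earlier zero of [F]; a larger one would need a certified successor
   value at [y], where [F] vanishes. *)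
case: (ltngtP y' y) => // [/Flt|/dS[z /((cF _).2 _ _ vD)]]; first by rewrite -F0.
by rewrite Fy0.
Qed.

(** Programs take one number. Coding cons by [pr] suits primitive recursion and minimization, which
    prepend an argument. *)
Fixpoint enc (s : seq nat) : nat := if s is x :: s' then pr x (enc s') else 0.

Lemma recursive_computes n (F : n.-tuple nat -> nat) : recursive F ->
  exists c, forall v : n.-tuple nat, computes c (enc v) (F v).
Proof.
elim=> {n F}.
- by move=> n; exists (pr 0 0) => v; exact: computes_zero.
- exists (pr 1 0) => -[[|x []] // sz] /=.
  by rewrite /thead (tnth_nth 0); exact: computes_succ.
- move=> n i.
  (* The projection takes [i] tails and then a head. *)
  suff [c Hc] : exists c, forall s, i < size s -> computes c (enc s) (nth 0 s i).
    by exists c => v; rewrite (tnth_nth 0); apply: Hc; rewrite size_tuple.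
  elim: (nat_of_ord i) => [|k [c Hc]].
    by exists (pr 2 0) => -[|x s] //= _; exact: computes_head.
  exists (pr 5 (pr c (pr 3 0))) => -[|x s] //= lt.
  exact: computes_comp (computes_tail _ _) (Hc _ lt).
- move=> m n f g _ [cf Hf] _ Hg.
  (* A single program computes the code of the list of all inner values. *)
  suff [c Hc] : exists c, forall v : n.-tuple nat,
      computes c (enc v) (enc [seq g i v | i <- enum 'I_m]).
    exists (pr 5 (pr cf c)) => v; apply: computes_comp (Hc v) _.
    exact: (Hf [tuple g i v | i < m]).
  elim: (enum 'I_m) => [|i s [c Hc]].
    by exists (pr 0 0) => v; exact: computes_zero.
  have [ci Hci] := Hg i; exists (pr 4 (pr ci c)) => v.
  exact: computes_cons.
- move=> n f g h _ [cf Hf] _ [cg Hg] h0 hS.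
  exists (pr 6 (pr cf cg)) => v; rewrite (tuple_eta v) /=.
  elim: (thead v) => [|k IHk]; first by rewrite h0; exact: computes_prim0.
  by rewrite hS; apply: computes_primS IHk _; exact: Hg [tuple of _ :: _ :: _].
- move=> n f h _ [cf Hf] h0 hlt; exists (pr 7 cf) => v.
  apply: (computes_mu (F := fun k => f [tuple of k :: v])) => // k.
    exact: Hf [tuple of _ :: _].
  exact: hlt.
- by move=> n f g fg _ [c Hc]; exists c => v; rewrite -fg.
Qed.

(* [pr x (pr s 0)] is [enc [:: x; s]]. *)
Definition rises (p t : nat) : bool := valid t &&
  bex p.+1 (fun c => bex p.+1 (fun x => (p == pr c x) &&
    bex t (fun s => bit t (fact c (pr x (pr s 0)) 1)))).

Definition falls (p t : nat) : bool := valid t &&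
  bex p.+1 (fun c => bex p.+1 (fun x => (p == pr c x) &&
    bex t (fun s' => bex s' (fun s => bit t (fact c (pr x (pr s 0)) 1) &&
                                      bit t (fact c (pr x (pr s' 0)) 0))))).

(** Codes of partial programs, or of approximations with many changes, do no harm: the shape of the
    set alone makes it 2-c.e., and the reductions use only codes of total approximations with at
    most two changes. *)
Definition universal_Sigma2inv : set nat :=
  [set p | (exists t, rises p t) /\ ~ exists t, falls p t].

Lemma Sigma2inv_universal : Sigma2inv universal_Sigma2inv.
Proof.
apply: Sigma2inv_difference.
- exact: (@computable2_evt (Ind (And (Rel2 computable2_valid (Var 1) (Var 0))
    (Ex (SuccT (Var 0)) (Ex (SuccT (Var 1))
      (And (EqF (Var 2) (PrT (Var 1) (Var 0)))
      (Ex (Var 3) (BitF (Var 4)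
        (FactT (Var 2) (PrT (Var 1) (PrT (Var 0) (Cst 0))) (Cst 1)))))))))).
- exact: (@computable2_evt (Ind (And (Rel2 computable2_valid (Var 1) (Var 0))
    (Ex (SuccT (Var 0)) (Ex (SuccT (Var 1))
      (And (EqF (Var 2) (PrT (Var 1) (Var 0)))
      (Ex (Var 3) (Ex (Var 0)
        (And (BitF (Var 5)
               (FactT (Var 3) (PrT (Var 2) (PrT (Var 0) (Cst 0))) (Cst 1)))
             (BitF (Var 5) (FactT (Var 3)
               (PrT (Var 2) (PrT (Var 1) (Cst 0))) (Cst 0)))))))))))).
Qed.

Lemma universal_Sigma2inv_hard B :
  Sigma2inv B -> many_one_reducible B universal_Sigma2inv.
Proof.
move=> [f [cf f0 flim fchg]].
have [c Hc] := recursive_computes cf.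
have {}Hc x s : computes c (pr x (pr s 0)) (f x s) by exact: Hc [tuple x; s].
have dec x s t (b : bool) : valid t -> bit t (fact c (pr x (pr s 0)) b) -> f x s = b.
  by move=> vt /((Hc x s).2 _ _ vt); case: b (f x s) => -[].
have der x s : derivable c (pr x (pr s 0)) (f x s) by exact: (Hc x s).1.
(* A stage mentioned in a certificate lies below its code, so the searches bounded by [t] miss
   nothing. *)
have ltt t x s y : bit t (fact c (pr x (pr s 0)) y) -> s < t.
  move=> /bit_lt; apply: leq_ltn_trans; apply: leq_trans (leq_fact2 _ _ _).
  exact: leq_trans (leq_prl _ _) (leq_prr _ _).
exists (pr c).
  exact: (@computable1_evt (PrT (Cst c) (Var 0))).
move=> x; rewrite (Sigma2inv_rise_fall f0 flim fchg x) /universal_Sigma2inv /=.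
have lec : c < (pr c x).+1 by rewrite ltnS leq_prl.
have lex : x < (pr c x).+1 by rewrite ltnS leq_prr.
have riseE : (exists s, f x s) <-> exists t, rises (pr c x) t.
  split=> [[s fs]|[t /andP[vt]]].
    have [D vD] := der x s; rewrite fs => dD; exists D; rewrite /rises vD.
    apply/bexP; exists c => //; apply/bexP; exists x; rewrite // eqxx.
    by apply/bexP; exists s => //; exact: ltt dD.
  move=> /bexP[c' _ /bexP[x' _ /andP[/eqP/pr_inj[<- <-] /bexP[s _ d]]]].
  by exists s; exact: (dec x s t true vt d).
have fallE : (exists s t, [/\ s < t, f x s & ~~ f x t]) <->
    exists t, falls (pr c x) t.
  split=> [[s [s' [lt_s fs /negbTE fs']]]|[t /andP[vt]]].
    have [D vD] := derivable2 (der x s) (der x s'); rewrite fs fs' => -[d d'].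
    exists D; rewrite /falls vD.
    apply/bexP; exists c => //; apply/bexP; exists x; rewrite // eqxx.
    apply/bexP; exists s'; first exact: ltt d'.
    by apply/bexP; exists s => //; rewrite d d'.
  move=> /bexP[c' _ /bexP[x' _ /andP[/eqP/pr_inj[<- <-]]]].
  move=> /bexP[s' _ /bexP[s lt_s /andP[d d']]].
  exists s, s'; rewrite lt_s (dec x s t true vt d).
  by rewrite (dec x s' t false vt d').
by rewrite riseE fallE.
Qed.

(** * Trails and finite Eulerian graphs *)

Definition inc (u : nat) (e : edge) : nat := (e.1.1 == u) + (e.1.2 == u).

Definition other (e : edge) (u : nat) : nat :=
  if e.1.1 == u then e.1.2 else e.1.1.

Definition degL (u : nat) (L : seq edge) : nat := \sum_(e <- L) inc u e.

(** A walk is given by its start and its edges; the vertices are recovered through [other]. *)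
Fixpoint walk (a : nat) (T : seq edge) : bool :=
  if T is e :: T' then (0 < inc a e) && walk (other e a) T' else true.

Definition endv (a : nat) (T : seq edge) : nat :=
  foldl (fun u e => other e u) a T.

Lemma walk_cat a T1 T2 : walk a (T1 ++ T2) = walk a T1 && walk (endv a T1) T2.
Proof. by elim: T1 a => //= e T1 IH a; rewrite IH andbA. Qed.

Lemma endv_cat a T1 T2 : endv a (T1 ++ T2) = endv (endv a T1) T2.
Proof. exact: foldl_cat. Qed.

Lemma incP u e : reflect (e.1.1 = u \/ e.1.2 = u) (0 < inc u e).
Proof.
rewrite /inc addn_gt0 !lt0b; apply: (iffP orP) => -[/eqP|/eqP]; by [left|right].
Qed.

Lemma inc_other e a : 0 < inc a e -> 0 < inc (other e a) e.
Proof.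
by rewrite /inc /other; case: (e.1.1 =P a) => [->|_]; rewrite eqxx ?addn1.
Qed.

Lemma joins_other e a : 0 < inc a e -> joins e a (other e a).
Proof.
rewrite /joins /other; case: e => -[u v] i /incP /=.
case: eqP => [->|ne [//|->]]; by [left|right].
Qed.

Lemma joins_inc e a b : joins e a b -> 0 < inc a e /\ other e a = b.
Proof.
case: e => -[u v] i [] /= [-> ->]; rewrite /inc /other /= eqxx ?addn1 //.
by case: eqP => [->|_].
Qed.

Lemma odd_inc a e u : 0 < inc a e -> odd (inc u e) = (u == a) (+) (u == other e a).
Proof.
move=> /joins_other; set b := other e a.
by case: e @b => -[v w] i b [] /= [-> ->]; rewrite /inc /= oddD !oddb
  !(eq_sym u) // addbC.
Qed.

Lemma degL_cat u L1 L2 : degL u (L1 ++ L2) = degL u L1 + degL u L2.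
Proof. exact: big_cat. Qed.

Lemma degL_perm u L1 L2 : perm_eq L1 L2 -> degL u L1 = degL u L2.
Proof. exact: perm_big. Qed.

(** Modulo 2 each edge contributes the indicators of its two ends, and these telescope along the
    walk. *)
Lemma odd_degL_walk u a T :
  walk a T -> odd (degL u T) = (u == a) (+) (u == endv a T).
Proof.
elim: T a => [|e T IH] a /=; first by rewrite /degL big_nil addbb.
case/andP=> ia wT; rewrite /degL big_cons oddD (odd_inc u ia) -/(degL u T).
by rewrite (IH _ wT) -addbA; congr (_ (+) _); rewrite addbA addbb.
Qed.

Lemma degL_gt0 u L : 0 < degL u L -> exists2 e, e \in L & 0 < inc u e.
Proof.
rewrite /degL lt0n sum_nat_seq_neq0 => /hasP[e eL /=].
by rewrite -lt0n => ie; exists e.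
Qed.

Lemma degL_eq u L1 L2 : uniq L1 -> uniq L2 ->
  (forall e, 0 < inc u e -> (e \in L1) = (e \in L2)) -> degL u L1 = degL u L2.
Proof.
move=> u1 u2 L12.
have degF L : degL u L = degL u [seq e <- L | 0 < inc u e].
  rewrite /degL big_filter [LHS](bigID (fun e => 0 < inc u e)) /=.
  by rewrite [X in _ + X]big1 ?addn0 // => e; rewrite -eqn0Ngt => /eqP.
rewrite degF [RHS]degF; apply/degL_perm/uniq_perm; rewrite ?filter_uniq //.
by move=> e; rewrite !mem_filter; case: (ltnP 0 (inc u e)) => // /L12.
Qed.

Lemma degL0 u L : (forall e, e \in L -> inc u e = 0) -> degL u L = 0.
Proof. by move=> L0; rewrite /degL big1_seq // => e /L0. Qed.

Definition visits (a : nat) (T : seq edge) (u : nat) : Prop :=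
  exists T1 T2, T = T1 ++ T2 /\ endv a T1 = u.

Lemma visits_start a T : visits a T a.
Proof. by exists [::], T. Qed.

Lemma visits_walk a T e u : walk a T -> e \in T -> 0 < inc u e -> visits a T u.
Proof.
move=> + eT; case/path.splitPr: eT => T1 T2.
rewrite walk_cat => /andP[_ /= /andP[/joins_other j _]] /incP.
suff: visits a (T1 ++ e :: T2) e.1.1 /\ visits a (T1 ++ e :: T2) e.1.2.
  by move=> [v1 v2] [<-|<-].
have va : visits a (T1 ++ e :: T2) (endv a T1) by exists T1, (e :: T2).
have vb : visits a (T1 ++ e :: T2) (other e (endv a T1)).
  by exists (rcons T1 e), T2; rewrite cat_rcons -cats1 endv_cat.
by case: j => ->.
Qed.

(* Connectedness of the edge set E from a, phrased by cuts. *)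
Definition conn (E : edge -> Prop) (a : nat) : Prop :=
  forall X : nat -> Prop, X a -> (forall e, E e -> (X e.1.1 <-> X e.1.2)) ->
  forall e, E e -> X e.1.1.

Lemma perm_cat_rest (H T : seq edge) : uniq H -> uniq T -> {subset T <= H} ->
  perm_eq H (T ++ [seq e <- H | e \notin T]).
Proof.
move=> uH uT sT; apply: uniq_perm => //.
  rewrite cat_uniq uT filter_uniq // andbT.
  by apply/hasPn => e; rewrite mem_filter => /andP[].
by move=> e; rewrite mem_cat mem_filter; case: (boolP (e \in T)) => // /sT.
Qed.

Lemma greedy_trail (H : seq edge) a b T : uniq H ->
  (forall u, odd (degL u H) = (u == a) (+) (u == b)) ->
  uniq T -> {subset T <= H} -> walk a T ->
  exists Q, [/\ uniq (T ++ Q), {subset T ++ Q <= H}, walk a (T ++ Q) &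
                endv a (T ++ Q) = b].
Proof.
move=> uH oH; have [n] := ubnP (size H - size T).
elim: n T => // n IH T ltn uT sT wT; have [eb|neb] := eqVneq (endv a T) b.
  by exists [::]; rewrite cats0.
have perH := perm_cat_rest uH uT sT.
have [e] : exists2 e, e \in [seq e <- H | e \notin T] & 0 < inc (endv a T) e.
  apply: degL_gt0; apply: odd_gt0; have := oH (endv a T).
  rewrite (degL_perm _ perH) degL_cat oddD (odd_degL_walk _ wT) eqxx.
  by rewrite (negbTE neb) addbT addbF; case: (_ == a) (odd _) => -[].
rewrite mem_filter => /andP[eT eH] ie.
have ltTH : size T < size H.
  rewrite (perm_size perH) size_cat -addn1 leq_add2l -has_predT.
  by apply/hasP; exists e => //; rewrite mem_filter eT.
have [||||Q [uQ sQ wQ eQ]] := IH (rcons T e).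
- rewrite size_rcons; lia.
- by rewrite rcons_uniq eT.
- by move=> x; rewrite mem_rcons inE => /predU1P[->//|/sT].
- by rewrite -cats1 walk_cat wT /= ie.
by exists (e :: Q); rewrite -cat_rcons.
Qed.

Lemma euler_trail_extend (H : seq edge) a b T : uniq H ->
  (forall u, odd (degL u H) = (u == a) (+) (u == b)) ->
  conn (fun e => e \in H) a ->
  uniq T -> {subset T <= H} -> walk a T -> endv a T = b ->
  exists T', [/\ uniq T', T' =i H, walk a T' & endv a T' = b].
Proof.
move=> uH oH cH; have [n] := ubnP (size H - size T).
elim: n T => // n IH T ltn uT sT wT eT.
case: (EM (exists2 e, e \in H & e \notin T)) => [[e0 e0H e0T]|nex]; last first.
  exists T; split=> // e; apply/idP/idP => [/sT//|eH].
  by apply: contraT => eT'; case: nex; exists e.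
have [u [e [[T1 [T2 [eT12 eu]]] eH eT' ie]]] : exists u e,
    [/\ visits a T u, e \in H, e \notin T & 0 < inc u e].
  apply: contrapT => nu; apply: (nu); exists e0.1.1, e0; split=> //; last first.
    by apply/incP; left.
  apply: (cH (visits a T)) => //; first exact: visits_start.
  move=> e eH; case: (boolP (e \in T)) => eT'.
    by split=> _; apply: (visits_walk wT eT'); apply/incP; auto.
  by split=> ve; case: nu; [exists e.1.1, e|exists e.1.2, e]; split=> //;
    apply/incP; auto.
pose R := [seq e <- H | e \notin T].
have uR : uniq R by rewrite filter_uniq.
have perH : perm_eq H (T ++ R) := perm_cat_rest uH uT sT.
(* All degrees in the rest are even, written in the form that [greedy_trail] expects for a closed
   trail at [u]. *)
have oR v : odd (degL v R) = (v == u) (+) (v == u).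
  have := oH v; rewrite (degL_perm _ perH) degL_cat oddD (odd_degL_walk _ wT).
  by rewrite eT addbb => /(congr1 (addb ((v == a) (+) (v == b)))); rewrite addKb addbb.
have [||//|Q [uQ sQ wQ eQ]] := greedy_trail (T := [:: e]) uR oR.
- by [].
- by move=> f; rewrite inE => /eqP->; rewrite mem_filter eT'.
- by rewrite /= ie.
have perT : perm_eq (T1 ++ ([:: e] ++ Q) ++ T2) (T ++ [:: e] ++ Q).
  by rewrite eT12 -!catA perm_cat2l catA perm_catC.
apply: (IH (T1 ++ ([:: e] ++ Q) ++ T2)).
- have : 0 < size R.
    by rewrite -has_predT; apply/hasP; exists e => //; rewrite mem_filter eT'.
  move: ltn; rewrite (perm_size perT) (perm_size perH) !size_cat /=.
  by move: (size T) (size R) (size Q) => i j k; clear; lia.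
- rewrite (perm_uniq perT) cat_uniq uT uQ andbT; apply/hasPn => f /sQ.
  by rewrite mem_filter => /andP[].
- move=> f; rewrite (perm_mem perT) mem_cat => /orP[/sT//|/sQ].
  by rewrite mem_filter => /andP[].
- move: wT; rewrite eT12 !walk_cat eu => /andP[-> wT2].
  by move: wQ; rewrite walk_cat => ->; rewrite eQ wT2.
- by rewrite endv_cat eu endv_cat eQ -eu -endv_cat -eT12.
Qed.

(** * Eulerian paths in one-ended graphs *)

(** Edges away from [u] are allowed in [L], so that a whole trail can serve to count the degree of
    [u]. *)
Definition covers (G : multigraph) (u : nat) (L : seq edge) : Prop :=
  [/\ uniq L, forall e, e \in L -> edges G e &
      forall e, edges G e -> 0 < inc u e -> e \in L].

Lemma incident_list G u d : has_degree G u d -> exists L,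
  [/\ uniq L, forall e, e \in L <-> edges G e /\ 0 < inc u e & degL u L = d].
Proof.
move=> [N [HN ->]].
pose L : seq edge :=
  [seq (minn u w, maxn u w, i) | w <- iota 0 N, i <- iota 0 (mult G u w)].
exists L; split.
- apply: allpairs_uniq_dep => [|w _|]; rewrite ?iota_uniq //.
  by case=> [w i] [w' i'] _ _ /= [emin emax ->]; congr existT; lia.
- case=> -[v w] i; split=> [/allpairsPdep[x [j [_ ]]]|].
    rewrite mem_iota => /= ltj [-> -> ->]; split; last first.
      by apply/incP => /=; lia.
    split => /=; first lia.
    rewrite /minn /maxn; case: ifP => _ //; by rewrite mult_sym.
  move=> [[/= le_vw lti] /incP /= vw].
  pose x := if v == u then w else v.
  have mx : mult G u x = mult G v w.
    rewrite /x; case: vw => [->|->]; first by rewrite eqxx.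
    by case: eqP => [->//|_]; rewrite mult_sym.
  apply/allpairsPdep; exists x, i; split; last first.
  + have [-> ->] // : minn u x = v /\ maxn u x = w.
    by rewrite /x; case: eqP => ne; lia.
  + by rewrite mem_iota mx.
  + rewrite mem_iota /=; apply: contraT; rewrite -leqNgt => /HN.
    by rewrite mx => e0; rewrite e0 in lti.
- rewrite /degL big_allpairs_dep /=.
  (* The second term is nonzero only for loops and becomes the extra summand of [has_degree]. *)
  have loopE w : \sum_(i <- iota 0 (mult G u w)) inc u (minn u w, maxn u w, i) =
                 mult G u w + (w == u) * mult G u w.
    rewrite (eq_bigr (fun=> 1 + (w == u))); last by move=> i _; rewrite /inc /=; lia.
    by rewrite big_const_seq count_predT size_iota iter_addn_0 mulnDl mul1n.
  under eq_bigr do rewrite loopE.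
  rewrite big_split /= -[N in iota 0 N]subn0 !big_mkord; congr (_ + _).
  case: (ltnP u N) => [ltuN|leNu].
    rewrite (bigD1 (Ordinal ltuN)) //= eqxx mul1n big1 ?addn0 // => w.
    by rewrite -val_eqE /= => /negbTE->.
  rewrite HN // big1 // => w _; rewrite (_ : (w == u :> nat) = false) //.
  by have := ltn_ord w; lia.
Qed.

Lemma degree_covers G u d L : has_degree G u d -> covers G u L -> degL u L = d.
Proof.
move=> /incident_list[L' [uL' L'P <-]] [uL sL cL]; apply: degL_eq => // e ie.
by apply/idP/idP => [/sL eG|/L'P[/cL]]; [apply/L'P|exact].
Qed.

Definition odd_vertex (G : multigraph) (u : nat) : Prop :=
  vert G u /\ exists2 d, has_degree G u d & odd d.

Lemma joins_vert G e u v : edges G e -> joins e u v -> vert G u /\ vert G v.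
Proof.
case: e => -[x y] i [/= _ lti] j.
have vx : vert G x by apply: (@mult_vert _ _ y); exact: leq_ltn_trans lti.
have vy : vert G y.
  by apply: (@mult_vert _ _ x); rewrite mult_sym; exact: leq_ltn_trans lti.
by case: j => /= -[<- <-].
Qed.

Lemma edge_list_max (x : nat -> edge) (L : seq edge) :
  (forall e, e \in L -> exists n, x n = e) ->
  exists N, forall e, e \in L -> exists2 n, n < N & x n = e.
Proof.
elim: L => [|e L IH] HL; first by exists 0.
have [f fL|N HN] := IH; first by apply: HL; rewrite inE fL orbT.
have [n xn] := HL e (mem_head _ _); exists (maxn n.+1 N) => f.
rewrite inE => /predU1P[->|/HN[m ltm xm]]; first by exists n => //; exact: leq_maxl.
by exists m => //; exact: leq_trans ltm (leq_maxr _ _).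
Qed.

(** For each [u] some initial segment of the path contains all edges at [u]; its parity at [u] is
    that of the degree. *)
Lemma eulerian_odd_vertex G : locally_finite G -> one_way_eulerian G ->
  exists r, forall u, odd_vertex G u <-> u = r.
Proof.
move=> lfG [v [x [jx ux]]].
have xinj m n : x m = x n -> m = n.
  move=> e; have [k [_ uk]] := ux _ (jx n).1.
  by rewrite -(uk m e) -(uk n erefl).
pose T n := [seq x i | i <- iota 0 n].
have TS n : T n.+1 = T n ++ [:: x n] by rewrite /T -[in iota _ _]addn1 iotaD map_cat.
have wT n : walk (v 0) (T n) /\ endv (v 0) (T n) = v n.
  elim: n => // n [wn en]; have [ix ox] := joins_inc (jx n).2.
  by rewrite TS walk_cat endv_cat wn en /= ix ox.
have uT n : uniq (T n) by rewrite map_inj_in_uniq ?iota_uniq // => i j _ _ /xinj.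
have TP n e : e \in T n -> exists2 i, i < n & e = x i.
  by case/mapP => i; rewrite mem_iota => lti ->; exists i.
have odd_deg u d : has_degree G u d -> odd d = (u == v 0).
  move=> hd; have [L [_ LP _]] := incident_list hd.
  have [e /LP[eG _]|N HN] := @edge_list_max x L.
    by have [n [xn _]] := ux _ eG; exists n.
  have cT : covers G u (T N).
    split=> // e; first by move/TP => [i _ ->]; exact: (jx i).1.
    move=> eG ie; have /HN[n ltn <-] : e \in L by apply/LP.
    by apply/map_f; rewrite mem_iota.
  rewrite -(degree_covers hd cT) (odd_degL_walk _ (wT N).1) (wT N).2.
  (* The path cannot stand at [u] at time [N]: its next edge [x N] would be at [u], hence among the
     first [N] edges. *)
  case: (u =P v N) => [e|_]; last by rewrite addbF.
  have /HN[n ltn /xinj en] : x N \in L.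
    by apply/LP; split; [exact: (jx N).1|rewrite e; exact: (joins_inc (jx N).2).1].
  by rewrite en ltnn in ltn.
exists (v 0) => u; split=> [[_ [d /odd_deg-> /eqP]]//|->].
have v0 : vert G (v 0) := (joins_vert (jx 0).1 (jx 0).2).1.
by split=> //; have [d hd] := lfG _ v0; exists d => //; rewrite (odd_deg _ _ hd).
Qed.

(** Stated for covering lists and for all numbers [u], so that later parity counts need neither
    degrees nor membership in [vert]. *)
Definition only_odd (G : multigraph) (r : nat) : Prop :=
  forall u L, covers G u L -> odd (degL u L) = (u == r).

Lemma inc_vert G u e : edges G e -> 0 < inc u e -> vert G u.
Proof. by move=> eG /joins_other /(joins_vert eG)[]. Qed.

Lemma unique_odd_only_odd G r : locally_finite G ->
  (forall u, odd_vertex G u <-> u = r) -> vert G r /\ only_odd G r.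
Proof.
move=> lfG oddG; have [vr [d hd od]] := (oddG r).2 erefl; split=> // u L cL.
have [eur|neur] := eqVneq u r.
  by rewrite -eur in hd; rewrite (degree_covers hd cL).
apply/negP => oL; have [e eL ie] := degL_gt0 (odd_gt0 oL).
have vu : vert G u by apply: inc_vert ie; case: cL => _ + _; exact.
have [d' hd'] := lfG _ vu; move/eqP: neur; apply; apply/oddG; split=> //.
by exists d' => //; rewrite -(degree_covers hd' cL).
Qed.

Lemma incident_finite G : locally_finite G -> forall us : seq nat,
  exists L : seq edge, forall e, edges G e ->
    (exists2 u, u \in us & 0 < inc u e) -> e \in L.
Proof.
move=> lfG; elim=> [|u us [L HL]]; first by exists [::] => e _ [].
have [L' HL'] : exists L' : seq edge,
    forall e, edges G e -> 0 < inc u e -> e \in L'.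
  have [/lfG[d /incident_list[L' [_ L'P _]]]|nv] := boolP (vert G u).
    by exists L' => e eG ie; apply/L'P.
  by exists [::] => e eG /(inc_vert eG); rewrite (negbTE nv).
exists (L' ++ L) => e eG [w]; rewrite mem_cat in_cons => /orP[/eqP->|wus] ie.
  by rewrite HL'.
by rewrite HL ?orbT //; exists w.
Qed.

(** * Components after the removal of finitely many edges *)

Definition off (G : multigraph) (F : seq edge) (e : edge) : Prop :=
  edges G e /\ e \notin F.

Definition comp (G : multigraph) (F : seq edge) : nat -> set nat :=
  component G [set` F].

Lemma joins_self (e : edge) : joins e e.1.1 e.1.2.
Proof. by left; case: e.1. Qed.

Lemma comp_inv G F (X : nat -> Prop) :
  (forall e, off G F e -> (X e.1.1 <-> X e.1.2)) ->
  forall u v, comp G F u v -> (X u <-> X v).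
Proof.
move=> XF u v; elim=> {u v} [u v [e [eG /= /negP eF]]|u|u v w _ -> _ ->] //.
by move: (XF e (conj eG eF)) => XE [] ee; rewrite ee in XE; case: XE.
Qed.

Lemma comp_refl G F u : comp G F u u.
Proof. exact: rt_refl. Qed.

Lemma comp_nil G : comp G [::] = component G set0.
Proof. by rewrite /comp (_ : [set` [::]] = set0) //; apply/seteqP; split. Qed.

Lemma comp_edge G F v e : off G F e -> (comp G F v e.1.1 <-> comp G F v e.1.2).
Proof.
move=> [eG /negP eF].
by split=> c; apply: rt_trans c _; apply: rt_step; exists e; split=> //;
  [left|right]; case: e.1.
Qed.

Lemma comp_eq G F u v : comp G F u v -> comp G F u = comp G F v.
Proof.
move=> cuv; apply/seteqP; split=> w cw; last exact: rt_trans cuv cw.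
(* Symmetry comes from invariance: lying in the component of [v] passes back along edges from [v] to
   [u]. *)
have H := comp_inv (@comp_edge G F v).
by apply/(H _ _ cw); apply/(H _ _ cuv); exact: comp_refl.
Qed.

Lemma inc_cases e u w : 0 < inc u e -> 0 < inc w e -> w = u \/ w = other e u.
Proof.
case: e => -[x y] i /incP /= xy /incP /= xy'; rewrite /other /=.
by case: eqP => ?; intuition congruence.
Qed.

Lemma odd_sum (I : eqType) (s : seq I) (F H : I -> nat) :
  (forall i, i \in s -> odd (F i) = odd (H i)) ->
  odd (\sum_(i <- s) F i) = odd (\sum_(i <- s) H i).
Proof.
move=> FH; rewrite !(big_morph odd oddD (erefl (odd 0))).
by apply: eq_big_seq.
Qed.

Lemma sum_eq_uniq (s : seq nat) v : uniq s -> v \in s -> \sum_(u <- s) (v == u) = 1.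
Proof.
move=> us vs; transitivity (count_mem v s); last by rewrite count_uniq_mem ?vs.
rewrite -sum1_count [RHS]big_mkcond /=; apply: eq_bigr => u _.
by rewrite eq_sym; case: eqP.
Qed.

(* Handshake: otherwise the end of the trail would be the only vertex of odd
   degree in a finite component. *)
Lemma trail_end_infinite G r F : locally_finite G -> only_odd G r ->
  uniq F -> (forall e, e \in F -> edges G e) -> walk r F ->
  infinite_set (comp G F (endv r F)).
Proof.
move=> lfG oG uF sF wF; set b := endv r F => /finite_seqP[cs0 cbE].
pose cs := undup cs0; have ucs : uniq cs by exact: undup_uniq.
have csP u : u \in cs <-> comp G F b u by rewrite mem_undup cbE.
have [L0 HL0] := incident_finite lfG cs.
pose L := undup [seq e <- L0 | `[< off G F e /\ e.1.1 \in cs >]].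
have uL : uniq L by exact: undup_uniq.
have csE e : off G F e -> (e.1.1 \in cs) = (e.1.2 \in cs).
  by move=> oe; apply/idP/idP => /csP /(comp_edge _ oe) /csP.
have LP e : e \in L <-> off G F e /\ e.1.1 \in cs.
  rewrite mem_undup mem_filter; split=> [/andP[/asboolP]//|oe].
  apply/andP; split; first exact/asboolP.
  by apply: HL0 => //; [exact: oe.1.1|exists e.1.1; [exact: oe.2|apply/incP; left]].
have oddL u : u \in cs -> odd (degL u L) = (b == u).
  move=> ucs'.
  have cFL : covers G u (F ++ L).
    split=> [|e|e eG ie].
    - rewrite cat_uniq uF uL andbT; apply/hasPn => e /LP[[_ eF] _]; exact: eF.
    - by rewrite mem_cat => /orP[/sF//|/LP[[]]].
    - rewrite mem_cat; case: (boolP (e \in F)) => //= eF; apply/LP; split=> //.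
      by case/incP: ie => [->//|e2]; rewrite csE // e2.
  have := oG _ _ cFL; rewrite degL_cat oddD (odd_degL_walk _ wF) -/b.
  by rewrite (eq_sym b); case: (u == r) (u == b) (odd _) => -[] [].
have bcs : b \in cs by apply/csP; exact: comp_refl.
have : odd (\sum_(u <- cs) degL u L).
  rewrite (odd_sum (H := fun u => b == u)); first by rewrite sum_eq_uniq.
  by move=> u /oddL->; rewrite oddb.
(* Counted by edges the sum is even, for both ends of each edge of [L] lie in the component. *)
rewrite /degL exchange_big /= big_seq (eq_bigr (fun=> 2)).
  by rewrite -big_seq big_const_seq iter_addn_0 oddM.
move=> e /LP[oe ecs]; rewrite big_split /= sum_eq_uniq // sum_eq_uniq //.
by rewrite -csE.
Qed.

Lemma card_le_I1 T (A : set T) x y : A #<= `I_1 -> A x -> A y -> x = y.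
Proof.
move=> /card_le_IP[f injf ltf] Ax Ay; apply: injf; rewrite ?inE //.
by move: (ltf _ Ax) (ltf _ Ay); rewrite !ltnS !leqn0 => /eqP-> /eqP->.
Qed.

Lemma walk_endv_vert G a T : vert G a -> (forall e, e \in T -> edges G e) ->
  walk a T -> vert G (endv a T).
Proof.
elim: T a => //= e T IH a va sT /andP[ie wT]; apply: IH wT.
  by apply: inc_vert (inc_other ie); apply: sT; rewrite mem_head.
by move=> f fT; apply: sT; rewrite inE fT orbT.
Qed.

(** Connectedness concerns edges only; vertices whose edges are all used up do not matter. *)
Definition good (G : multigraph) (r : nat) (T : seq edge) : Prop :=
  [/\ uniq T, forall e, e \in T -> edges G e, walk r T &
      conn (off G T) (endv r T)].

(** The set of ends of trails from [a] is closed under remaining edges: an edge already on the trail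
    has both ends visited, and a prefix of the trail reaches either one. *)
Lemma trail_through G T a y : conn (off G T) a -> off G T y ->
  exists P, [/\ uniq P, forall e, e \in P -> off G T e, walk a P & y \in P].
Proof.
move=> cT oy.
pose X u := exists P,
  [/\ uniq P, forall e, e \in P -> off G T e, walk a P & endv a P = u].
have Xstep u w e : off G T e -> 0 < inc u e -> 0 < inc w e -> X u -> X w.
  move=> oe iu iw [P [uP sP wP eP]].
  case: (boolP (e \in P)) => eP'.
    have [P1 [P2 [eP12 <-]]] := visits_walk wP eP' iw.
    exists P1; split=> //; move: uP sP wP; rewrite eP12.
    - by rewrite cat_uniq => /andP[].
    - by move=> _ sP _ f fP; apply: sP; rewrite mem_cat fP.
    - by rewrite walk_cat => _ _ /andP[].
  case: (inc_cases iu iw) => ->; first by exists P.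
  exists (rcons P e); rewrite rcons_uniq eP' uP -cats1 walk_cat endv_cat wP eP /= iu.
  by split=> // f; rewrite mem_cat inE => /orP[/sP//|/eqP->].
have iy (e : edge) : 0 < inc e.1.1 e /\ 0 < inc e.1.2 e.
  by split; apply/incP; auto.
have [P [uP sP wP eP]] : X y.1.1.
  apply: cT oy => [|e oe]; first by exists [::].
  by have [i1 i2] := iy e; split; apply: (Xstep _ _ e).
case: (boolP (y \in P)) => yP; first by exists P.
exists (rcons P y); rewrite rcons_uniq yP uP -cats1 walk_cat wP eP /= (iy y).1.
split=> //; last by rewrite mem_cat inE eqxx orbT.
by move=> f; rewrite mem_cat inE => /orP[/sP//|/eqP->].
Qed.

(* The components left by a trail P that do not contain its end are finite, and
   together they have finitely many edges because each of them meets P. *)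
Lemma finitely_many_off_end G r T P (F := T ++ P) (b := endv r F) :
  locally_finite G -> number_of_ends G 1 -> only_odd G r -> vert G r ->
  good G r T -> uniq P -> (forall e, e \in P -> off G T e) ->
  walk (endv r T) P ->
  exists2 S : seq edge, uniq S &
    forall e, e \in S <-> off G F e /\ ~ comp G F b e.1.1.
Proof.
move=> lfG [endG _] oG vr [uT sT wT cT] uP sP wP.
have sF e : e \in F -> edges G e by rewrite mem_cat => /orP[/sT|/sP[]].
have uF : uniq F.
  rewrite cat_uniq uT uP andbT; apply/hasPn => e /sP[_]; exact.
have wF : walk r F by rewrite walk_cat wT.
have infb : infinite_set (comp G F b) by exact: trail_end_infinite.
have vb : vert G b by exact: walk_endv_vert.
pose VP := endv r T :: flatten [seq [:: e.1.1; e.1.2] | e : edge <- P].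
have VPP e : e \in P -> e.1.1 \in VP /\ e.1.2 \in VP.
  move=> eP; rewrite !inE; split; apply/orP; right; apply/flattenP;
    exists [:: e.1.1; e.1.2]; rewrite ?inE ?eqxx ?orbT //; exact: map_f.
(* Before [P] was removed everything was connected to the end of [T], so each remaining piece
   contains that vertex or an end of an edge of [P]. *)
have VPcomp e : off G T e -> exists2 p, p \in VP & comp G F p e.1.1.
  move=> oe; apply: (cT (fun u => exists2 p, p \in VP & comp G F p u)) oe.
    by exists (endv r T); [exact: mem_head|exact: comp_refl].
  move=> f [fG fT]; case: (boolP (f \in P)) => fP.
    have [f1 f2] := VPP f fP.
    by split=> _; [exists f.1.2|exists f.1.1] => //; exact: comp_refl.
  have of_ : off G F f by split=> //; rewrite mem_cat negb_or fT.
  by split=> -[p pV /(comp_edge _ of_)]; exists p.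
have [U HU] : exists U : seq nat, forall p, p \in VP ->
    finite_set (comp G F p) -> forall w, comp G F p w -> w \in U.
  elim: (VP) => [|p V [U HU]]; first by exists [::].
  case: (EM (finite_set (comp G F p))) => [/finite_seqP[cs csE]|ninf].
    exists (cs ++ U) => q; rewrite inE => /orP[/eqP-> _ w|qV fq w].
      by rewrite csE mem_cat => /= ->.
    by rewrite mem_cat => /(HU q qV fq)->; rewrite orbT.
  exists U => q; rewrite inE => /orP[/eqP->//|]; exact: HU.
have [L HL] := incident_finite lfG U.
exists (undup [seq e <- L | `[< off G F e /\ ~ comp G F b e.1.1 >]]).
  exact: undup_uniq.
move=> e; rewrite mem_undup mem_filter; split=> [/andP[/asboolP]//|oe].
apply/andP; split; first exact/asboolP.
case: oe => -[eG eF] nb.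
have [|p pV cp] := VPcomp e.
  by split=> //; move: eF; rewrite mem_cat negb_or => /andP[].
apply: HL => //; exists e.1.1; last by apply/incP; left.
(* An infinite component would have to be that of [b], one-endedness leaving room for a single
   one. *)
apply: (HU p pV _ _ cp); apply: contrapT => infp; apply: nb.
have -> : comp G F b = comp G F p; last by [].
apply: (card_le_I1 (endG [set` F] (finite_seq F) _)) => //.
  by split=> //; exists b.
split=> //; exists e.1.1; first exact: (joins_vert eG (joins_self e)).1.
exact: comp_eq.
Qed.

Lemma good_extend G r T y :
  locally_finite G -> number_of_ends G 1 -> only_odd G r -> vert G r ->
  good G r T -> off G T y -> exists Q, y \in Q /\ good G r (T ++ Q).
Proof.
move=> lfG endG oG vr gT oy; have [uT sT wT cT] := gT.
have [P [uP sP wP yP]] := trail_through cT oy.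
have [S uS SP] := finitely_many_off_end lfG endG oG vr gT uP sP wP.
set F := T ++ P in SP; set b := endv r F in SP; set a := endv r T in wP cT.
have wF : walk r F by rewrite walk_cat wT.
have eb : endv a P = b by rewrite /b /F endv_cat.
have sF e : e \in F -> edges G e by rewrite mem_cat => /orP[/sT|/sP[]].
have uF : uniq F.
  rewrite cat_uniq uT uP andbT; apply/hasPn => e /sP[_]; exact.
have SF e : e \in S -> e \notin F by move=> /SP[[]].
have uFS : uniq (F ++ S).
  by rewrite cat_uniq uF uS andbT; apply/hasPn => e /SF.
have /and3P[_ TPS uPS] : [&& uniq T, ~~ has [in T] (P ++ S) & uniq (P ++ S)].
  by rewrite -cat_uniq catA.
have oPS u : odd (degL u (P ++ S)) = (u == a) (+) (u == b).
  rewrite degL_cat oddD (odd_degL_walk _ wP) eb.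
  (* If an edge of [S] meets [u], then [u] is outside the component of [b] and [F ++ S] covers [u];
     the parities of the trail [F] and of the full degree at [u] then agree. *)
  suff -> : odd (degL u S) = false by rewrite addbF.
  case: (EM (exists2 e, e \in S & 0 < inc u e)) => [[e /SP[oe nb] ie]|ne]; last first.
    rewrite degL0 // => e eS; apply/eqP; rewrite eqn0Ngt; apply/negP => ie.
    by apply: ne; exists e.
  have nbu : ~ comp G F b u.
    by case/incP: ie => <- //; move/(comp_edge _ oe).
  have cFS : covers G u (F ++ S).
    split=> // [f|f fG fu]; rewrite mem_cat; first by case/orP => [/sF//|/SP[[]]].
    case: (boolP (f \in F)) => //= fF; apply/SP; split=> //.
    by case/incP: fu => <- in nbu * => //; move/(comp_edge _ (conj fG fF)).
  have := oG _ _ cFS; rewrite degL_cat oddD (odd_degL_walk _ wF) -/b.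
  have /negbTE-> : u != b by apply/eqP => ub; apply: nbu; rewrite ub; exact: comp_refl.
  by rewrite addbF; case: (u == r) (odd _) => -[].
have cPS : conn (fun e => e \in P ++ S) a.
  move=> X Xa XE.
  have XP e u : e \in P -> 0 < inc u e -> X u.
    move=> eP iu; have [P1 [P2 [eP12 <-]]] := visits_walk wP eP iu.
    have: {subset P1 <= P} by move=> f; rewrite eP12 mem_cat => ->.
    have: walk a P1 by move: wP; rewrite eP12 walk_cat => /andP[].
    elim/last_ind: P1 {eP12} => // P1 f IH; rewrite -cats1 walk_cat endv_cat /=.
    move=> /andP[w1 /andP[if_ _]] sub.
    have X1 : X (endv a P1).
      by apply: IH => // g gP; apply: sub; rewrite mem_cat gP.
    have /XE : f \in P ++ S by rewrite mem_cat sub // mem_cat mem_head orbT.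
    by case: (joins_other if_) => -> /= [? ?]; auto.
  (* This disjunction is a cut closed under all edges off [T]: those of [P] have both ends in [X],
     the others lie in the component of [b] or in [S]. *)
  have XZ e : off G T e -> X e.1.1 \/ comp G F b e.1.1.
    apply: (cT (fun u => X u \/ comp G F b u)); first by left.
    move=> f of_; case: (boolP (f \in P)) => fP.
      by split=> _; left; apply: (XP f) => //; apply/incP; auto.
    have oF : off G F f by case: of_ => fG fT; split=> //; rewrite mem_cat negb_or fT.
    have CE := comp_edge b oF.
    case: (EM (comp G F b f.1.1)) => cb; first by split=> _; right => //; exact/CE.
    have /XE XEf : f \in P ++ S by rewrite mem_cat; apply/orP; right; apply/SP.
    by split=> -[/XEf|/CE]; auto.
  move=> e; rewrite mem_cat => /orP[eP|eS].
    by apply: XP eP _; apply/incP; left.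
  have [oe nb] := (SP e).1 eS; case: (XZ e) => //.
  by case: oe => eG; rewrite mem_cat negb_or => /andP[].
have sPS : {subset P <= P ++ S} by move=> e; rewrite mem_cat => ->.
have [Q [uQ QE wQ eQ]] := euler_trail_extend uPS oPS cPS uP sPS wP eb.
have TQ e : (e \in T ++ Q) = (e \in F ++ S) by rewrite !mem_cat QE mem_cat orbA.
exists Q; split; first by rewrite QE mem_cat yP.
have eTQ : endv r (T ++ Q) = b by rewrite endv_cat.
split.
- rewrite cat_uniq uT uQ andbT; apply/hasPn => e; rewrite QE.
  by move/hasPn: TPS; exact.
- by move=> e; rewrite TQ mem_cat => /orP[/sF//|/SP[[]]].
- by rewrite walk_cat wT.
rewrite eTQ => X Xb XE e [eG].
rewrite TQ mem_cat negb_or => /andP[eF eS].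
have cb : comp G F b e.1.1.
  by apply: contrapT => nb; case/negP: eS; apply/SP.
(* What remains after [T ++ Q] is the component of [b]. Restricting [X] to that component makes it
   invariant under the edges of [S] too. *)
have H : forall f, off G F f ->
    ((comp G F b f.1.1 /\ X f.1.1) <-> (comp G F b f.1.2 /\ X f.1.2)).
  move=> f oF; have CE := comp_edge b oF.
  case: (EM (comp G F b f.1.1)) => cf; last by split=> -[] // /CE.
  have /XE XEf : off G (T ++ Q) f.
    split; first exact: oF.1.
    rewrite TQ mem_cat negb_or oF.2; apply/negP => /SP[_]; exact.
  by split=> -[? ?]; split; [exact/CE|exact/XEf|exact/CE|exact/XEf].
have [/(_ (conj (comp_refl G F b) Xb))[]//] :=
  comp_inv (X := fun u => comp G F b u /\ X u) H cb.
Qed.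

Lemma good_next G r : locally_finite G -> number_of_ends G 1 -> only_odd G r ->
  vert G r -> forall T (k : nat), good G r T ->
  exists Q, [/\ 0 < size Q, good G r (T ++ Q) &
    forall y : edge, unpickle k = Some y -> edges G y -> y \in T ++ Q].
Proof.
move=> lfG endG oG vr T k gT; have [uT sT wT cT] := gT.
have [y oy ky] : exists2 y, off G T y &
    forall z : edge, unpickle k = Some z -> edges G z -> z \in T \/ z = y.
  case: (EM (exists2 y : edge, unpickle k = Some y & off G T y)) => [[y ky oy]|nk].
    by exists y => // z; rewrite ky => -[->]; right.
  (* With no edge left, the component of the end of [T] would be a single vertex, hence finite. *)
  have [y oy] : exists y, off G T y.
    apply: contrapT => noff; apply: (trail_end_infinite lfG oG uT sT wT).
    apply: (@sub_finite_set _ _ [set endv r T]); last exact: finite_set1.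
    move=> u cu /=; apply/(comp_inv (X := fun w => w = endv r T) _ cu) => // e oe.
    by case: noff; exists e.
  exists y => // z kz zG; left; apply: contraT => zT.
  by case: nk; exists z.
have [Q [yQ gQ]] := good_extend lfG endG oG vr gT oy.
exists Q; split=> //; first by case: (Q) yQ.
by move=> z kz /(ky _ kz)[zT|->]; rewrite mem_cat ?zT // yQ orbT.
Qed.

Lemma unique_odd_eulerian G r : connected G -> locally_finite G ->
  number_of_ends G 1 -> (forall u, odd_vertex G u <-> u = r) ->
  one_way_eulerian G.
Proof.
move=> cG lfG endG oddG; have [vr oG] := unique_odd_only_odd lfG oddG.
have g0 : good G r [::].
  split=> // X Xr XE e [eG eT].
  have vc := cG r e.1.1 vr (joins_vert eG (joins_self e)).1.
  by rewrite -comp_nil in vc; exact/(comp_inv XE vc).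
have /choice[nxt Hnxt] : forall p : seq edge * nat, exists Q, good G r p.1 ->
  [/\ 0 < size Q, good G r (p.1 ++ Q) &
    forall y : edge, unpickle p.2 = Some y -> edges G y -> y \in p.1 ++ Q].
  move=> [T k]; case: (EM (good G r T)) => [gT|]; last by exists [::].
  by have [Q HQ] := good_next lfG endG oG vr k gT; exists Q.
pose Ts := fix Ts k := if k is k'.+1 then Ts k' ++ nxt (Ts k', k') else [::].
have gTs k : good G r (Ts k).
  by elim: k => //= k IH; have [] := Hnxt (Ts k, k) IH.
have TsP k (y : edge) : unpickle k = Some y -> edges G y -> y \in Ts k.+1.
  by move=> ky yG; have [_ _ /(_ y ky yG)] := Hnxt (Ts k, k) (gTs k).
have szTs k : k <= size (Ts k).
  elim: k => //= k IH; have [szQ _ _] := Hnxt (Ts k, k) (gTs k).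
  by rewrite size_cat /= in szQ *; lia.
have pTs m n : m <= n -> exists R, Ts n = Ts m ++ R.
  move=> /subnKC <-; elim: (n - m) => [|k [R eR]].
    by exists [::]; rewrite addn0 cats0.
  by exists (R ++ nxt (Ts (m + k), m + k)); rewrite addnS /= {1}eR catA.
pose e0 : edge := (0, 0, 0).
(* [Ts n.+1] has more than [n] edges, so the default [e0] is never read. *)
pose x n := nth e0 (Ts n.+1) n.
pose v n := endv r (take n (Ts n)).
have xE k n : n < size (Ts k) -> nth e0 (Ts k) n = x n.
  move=> ltn; rewrite /x; have ltn' := szTs n.+1.
  case: (leqP k n.+1) => [/pTs|/ltnW/pTs] [R ->]; by rewrite nth_cat ?ltn ?ltn'.
have xmem n : x n \in Ts n.+1 by rewrite mem_nth.
exists v, x; split=> [n|y yG].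
  have [uT sT wT _] := gTs n.+1; split; first exact: sT.
  have ltn := szTs n.+1.
  have vn : v n = endv r (take n (Ts n.+1)).
    have [R ->] := pTs n n.+1 (leqnSn n).
    by rewrite /v takel_cat // szTs.
  have -> : v n.+1 = other (x n) (v n).
    by rewrite vn /v (take_nth e0 ltn) -cats1 endv_cat.
  apply: joins_other; rewrite vn; move: wT.
  rewrite -{1}(cat_take_drop n (Ts n.+1)) walk_cat => /andP[_].
  by rewrite (drop_nth e0 ltn) /= => /andP[].
have yT := TsP (pickle y) y (pickleK y) yG.
exists (index y (Ts (pickle y).+1)); split.
  by rewrite -(xE (pickle y).+1) ?index_mem // nth_index.
move=> n xn; set m := index _ _.
have xm : x m = y by rewrite -(xE (pickle y).+1) ?index_mem // nth_index.
have [uT _ _ _] := gTs (maxn m n).+1.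
have szm : maxn m n < size (Ts (maxn m n).+1) := szTs _.
have ltm := leq_ltn_trans (leq_maxl m n) szm.
have ltn := leq_ltn_trans (leq_maxr m n) szm.
by apply/eqP; rewrite -(nth_uniq e0 ltm ltn uT) !xE // xm xn.
Qed.

Lemma eulerian_unique_odd G : connected G -> locally_finite G ->
  number_of_ends G 1 ->
  one_way_eulerian G <-> exists r, forall u, odd_vertex G u <-> u = r.
Proof.
move=> cG lfG endG; split; first exact: eulerian_odd_vertex.
by move=> [r]; exact: unique_odd_eulerian.
Qed.

(** * The two reductions *)

Lemma has_degree_uniq G u d d' : has_degree G u d -> has_degree G u d' -> d = d'.
Proof.
move=> /incident_list[L [uL LP <-]] hd'; apply: degree_covers hd' _.
by split=> // e; [case/LP|move=> eG ie; apply/LP].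
Qed.

Lemma computable2_odd : computable2 (fun n _ => nat_of_bool (odd n)).
Proof.
apply: (@computable2_evt (Ind (Ex (Var 0)
  (EqF (Var 1) (SuccT (AddT (Var 0) (Var 0))))))) => n _ /=.
congr (nat_of_bool _); apply/bexP/idP => [[k _ /eqP->]|on].
  by rewrite /= oddD addbb.
by exists n./2; have := odd_double_half n; rewrite on; lia.
Qed.

Lemma Sigma2inv_eulerian (G : nat -> multigraph) :
  uniformly_highly_computable G ->
  (forall e, [/\ connected (G e), locally_finite (G e) &
                 number_of_ends (G e) 1]) ->
  Sigma2inv [set e | one_way_eulerian (G e)].
Proof.
move=> [_ [V [E [deg [[cV _ cdeg] [VP _ degP]]]]]] HG.
have {}cV : computable2 (fun e v => nat_of_bool (vert (G e) v)).
  suff -> : (fun e v => nat_of_bool (vert (G e) v)) = V by [].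
  by do 2 apply/funext => ?; rewrite VP.
pose p e v := vert (G e) v && odd (deg e v).
have pP e v : odd_vertex (G e) v <-> p e v.
  split=> [[vv [d hd od]]|/andP[vv od]].
    by rewrite /p vv (has_degree_uniq (degP _ _ vv) hd).
  by split=> //; exists (deg e v) => //; exact: degP.
(* An odd vertex that is not the least one; it exists iff there are at least two. *)
pose q e v := p e v && bex v (p e).
have cp : computable2 (fun e v => nat_of_bool (p e v)).
  exact: (@computable2_evt (Ind (And (Rel2 cV (Var 0) (Var 1))
    (Rel2 computable2_odd (App2 cdeg (Var 0) (Var 1)) (Cst 0))))).
have cq : computable2 (fun e v => nat_of_bool (q e v)).
  exact: (@computable2_evt (Ind (And (Rel2 cp (Var 0) (Var 1))
    (Ex (Var 1) (Rel2 cp (Var 1) (Var 0)))))).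
rewrite (_ : [set e | _] =
  [set e | (exists v, p e v) /\ ~ exists v, q e v]); first exact: Sigma2inv_difference.
apply/seteqP; split=> e /=; have [cG lfG endG] := HG e.
  move=> /(eulerian_unique_odd cG lfG endG)[r oddr].
  split; first by exists r; apply/pP/oddr.
  move=> [v /andP[/pP/oddr-> /bexP[w ltw /pP/oddr ew]]].
  by rewrite ew ltnn in ltw.
move=> [[r pr] nq]; apply/(eulerian_unique_odd cG lfG endG); exists r => u.
split=> [/pP pu|->]; last exact/pP.
case: (ltngtP u r) => // lt; case: nq; [exists r|exists u]; apply/andP.
  by split=> //; apply/bexP; exists u.
by split=> //; apply/bexP; exists r.
Qed.

(** * Rays with prescribed multiplicities *)

Definition ray_mult (h : nat -> nat) (u v : nat) : nat :=
  (v == u.+1) * h u + (u == v.+1) * h v.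

Lemma ray_mult_sym h u v : ray_mult h u v = ray_mult h v u.
Proof. exact: addnC. Qed.

Definition ray (h : nat -> nat) : multigraph :=
  @Multigraph predT (ray_mult h) (ray_mult_sym h) (fun _ _ _ => isT).

(** At [n = 0] the predecessor is again 0, and the first factor cancels the spurious term. *)
Definition ray_deg (h : nat -> nat) (n : nat) : nat := (0 < n) * h n.-1 + h n.

Lemma ray_mult0 h u v : v != u.+1 -> u != v.+1 -> ray_mult h u v = 0.
Proof. by rewrite /ray_mult => /negbTE-> /negbTE->. Qed.

Lemma ray_multS h n : ray_mult h n n.+1 = h n.
Proof.
rewrite /ray_mult eqxx mul1n (_ : (n == n.+2) = false) ?addn0 //.
by apply/eqP; lia.
Qed.

Lemma ray_degree h n : has_degree (ray h) n (ray_deg h n).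
Proof.
exists n.+2; split=> [w ltw|] /=; first by apply: ray_mult0; lia.
have m0 : ray_mult h n n = 0 by apply: ray_mult0; lia.
rewrite !big_ord_recr /= m0 ray_multS !addn0 /ray_deg; congr (_ + _).
case: n {m0} => [|n]; first by rewrite big_ord0.
rewrite big_ord_recr /= ray_mult_sym ray_multS mul1n big1 // => i _.
by apply: ray_mult0; have := ltn_ord i; lia.
Qed.

Lemma ray_locally_finite h : locally_finite (ray h).
Proof. by move=> n _; exists (ray_deg h n); exact: ray_degree. Qed.

Lemma ray_edge h n : 0 < h n -> edges (ray h) (n, n.+1, 0).
Proof. by move=> hn; split=> //=; rewrite /ray_mult eqxx mul1n addn_gt0 hn. Qed.

Lemma ray_tail h s N : (forall n, 0 < h n) ->
  (forall e : edge, e \in s -> e.1.1 < N) ->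
  forall n, N <= n -> comp (ray h) s N n.
Proof.
move=> h0 sN n /subnKC <-; elim: (n - N) => [|k IH].
  by rewrite addn0; exact: comp_refl.
rewrite addnS.
have oe : off (ray h) s (N + k, (N + k).+1, 0).
  by split; [exact: ray_edge|apply/negP => /sN /=; lia].
exact/(comp_edge N oe).
Qed.

Lemma ray_comp_nil h u v : (forall n, 0 < h n) -> comp (ray h) [::] u v.
Proof.
move=> h0; have H n : comp (ray h) [::] 0 n by exact: ray_tail.
by rewrite -(comp_eq (H u)).
Qed.

Lemma ray_connected h : (forall n, 0 < h n) -> connected (ray h).
Proof. by move=> h0 u v _ _; rewrite -comp_nil; exact: ray_comp_nil. Qed.

Lemma ray_one_end h : (forall n, 0 < h n) -> number_of_ends (ray h) 1.
Proof.
move=> h0; split=> [F /finite_seqP[s ->] _|].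
  pose N := (\max_(e <- s) (e : edge).1.1).+1.
  have sN (e : edge) : e \in s -> e.1.1 < N.
    by move=> es; rewrite ltnS; exact: leq_bigmax_seq.
  (* An infinite component has a vertex beyond [N], where the ray is untouched. *)
  have CN C : infinite_components (ray h) [set` s] C -> C = comp (ray h) s N.
    move=> [infC [v _ eC]]; have [w Cw leNw] : exists2 w, C w & N <= w.
      apply: contrapT => nw; apply: infC; apply: (@sub_finite_set _ _ `I_N).
        move=> w Cw /=; rewrite ltnNge; apply/negP => le.
        by apply: nw; exists w.
      exact: finite_II.
    rewrite eC in Cw *; rewrite (comp_eq (ray_tail h0 sN leNw)).
    exact: comp_eq.
  apply/card_le_IP; exists (fun=> 0) => // C C'; rewrite !inE => /CN-> /CN->//.
exists set0; split=> //.
apply: card_le_trans (card_image_le (fun=> 0) _); apply: subset_card_le.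
move=> [|//] _; exists setT => //; split; first exact: infinite_nat.
exists 0 => //; apply/seteqP; split=> // n _.
by rewrite -comp_nil; exact: ray_comp_nil.
Qed.

(** The current value is the parity of the number of changes so far; with at most two changes, the
    limit is true iff there is exactly one. *)
Lemma unique_change (f : nat -> bool) (A : Prop) : f 0 = false ->
  (exists s0, forall s, s0 <= s -> (f s <-> A)) ->
  [set s | f s <> f s.+1] #<= `I_2 ->
  A <-> exists k, forall l, f l <> f l.+1 <-> l = k.
Proof.
move=> f0 [s0 fA] /changes_card chg2.
have ochg n : odd (changes f n) = f n by rewrite odd_changes f0.
have chgS k : f k <> f k.+1 -> changes f k.+1 = (changes f k).+1.
  by move=> /eqP ck; rewrite changesS ck addn1.
split=> [tA|[k Hk]].
  have chg1 n : s0 <= n -> changes f n = 1.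
    move=> /fA fn; have := ochg n; rewrite (fn.2 tA).
    by have := chg2 n; case: (changes f n) => [|[|[]]].
  have [k ck] : exists k, f k <> f k.+1.
    apply: contrapT => nk; have := chg1 s0 (leqnn _).
    rewrite /changes (eq_count (a2 := pred0)) ?count_pred0 // => k /=.
    by apply/negbTE/negP => /eqP ck; apply: nk; exists k.
  have two i j : i < j -> f i <> f i.+1 -> f j <> f j.+1 -> False.
    move=> lt /chgS ci /chgS cj; have := leq_changes f lt.
    have := leq_changes f (leq_maxl j.+1 s0).
    by rewrite (chg1 (maxn _ _)) ?leq_maxr //; lia.
  exists k => l; split=> [cl|->//].
  by case: (ltngtP l k) => // lt; [case: (two l k)|case: (two k l)].
apply/(fA (maxn k.+1 s0)); first exact: leq_maxr.
rewrite -ochg /changes (eq_count (a2 := pred1 k)).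
  rewrite count_uniq_mem ?iota_uniq // mem_iota /= (_ : k < _) //.
  exact: leq_maxl.
by move=> l /=; apply/idP/eqP => [/eqP/Hk|/Hk/eqP].
Qed.

Lemma Sigma2inv_realized (W : set nat) : Sigma2inv W ->
  exists G : nat -> multigraph,
    [/\ uniformly_highly_computable G,
        forall e, [/\ connected (G e), locally_finite (G e) &
                      number_of_ends (G e) 1] &
        W = [set e | one_way_eulerian (G e)]].
Proof.
move=> [f [cf f0 flim fchg]].
(* Subtracting from 2 leaves parities alone and keeps every multiplicity positive, so the ray stays
   connected. *)
pose h e n := 2 - f e n; have h0 e n : 0 < h e n by rewrite /h; case: (f e n).
have HG e : [/\ connected (ray (h e)), locally_finite (ray (h e)) &
                number_of_ends (ray (h e)) 1].
  by split; [exact: ray_connected|exact: ray_locally_finite|exact: ray_one_end].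
exists (fun e => ray (h e)); split=> //.
- split; first by move=> e; case: (HG e).
  exists (fun _ _ => 1), (fun e => ray_mult (h e)), (fun e => ray_deg (h e)).
  pose hT e n := SubT (Cst 2) (App2 cf e n).
  split; split=> //; last by move=> e v _; exact: ray_degree.
  + exact: (@computable2_evt (Cst 1)).
  + exact: (@computable3_evt (AddT
      (MulT (Ind (EqF (Var 2) (SuccT (Var 1)))) (hT (Var 0) (Var 1)))
      (MulT (Ind (EqF (Var 1) (SuccT (Var 2)))) (hT (Var 0) (Var 2))))).
  + exact: (@computable2_evt (AddT
      (MulT (Ind (LtF (Cst 0) (Var 1)))
            (hT (Var 0) (App1 computable1_pred (Var 1))))
      (hT (Var 0) (Var 1)))).
have oddP e u : odd_vertex (ray (h e)) u <->
    exists2 k, u = k.+1 & f e k <> f e k.+1.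
  have -> : odd_vertex (ray (h e)) u <-> odd (ray_deg (h e) u).
    split=> [[_ [d hd]]|od]; first by rewrite (has_degree_uniq (ray_degree _ _) hd).
    by split=> //; exists (ray_deg (h e) u) => //; exact: ray_degree.
  (* The start of the ray has degree 2, because [f e 0] is false. *)
  case: u => [|u]; first by rewrite /ray_deg /h f0; split=> // -[].
  rewrite /ray_deg mul1n /h /=; split=> [od|[k [<-]]].
    by exists u => //; move: od; case: (f e u) (f e u.+1) => -[].
  by case: (f e u) (f e u.+1) => -[].
apply/seteqP; split=> e /=; have [cG lfG endG] := HG e.
  move=> /(unique_change (f0 e) (flim e) (fchg e))[k Hk].
  apply/(eulerian_unique_odd cG lfG endG); exists k.+1 => u; rewrite oddP.
  by split=> [[l -> /Hk->]//|->]; exists k => //; apply/Hk.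
move=> /(eulerian_unique_odd cG lfG endG)[r Hr].
apply/(unique_change (f0 e) (flim e) (fchg e)).
have /oddP[k ek ck] := (Hr r).2 erefl; exists k => l; split=> [cl|->//].
have /Hr : odd_vertex (ray (h e)) l.+1 by apply/oddP; exists l.
by rewrite ek => -[].
Qed.

Theorem theorem4p4 :
  (forall G : nat -> multigraph,
     uniformly_highly_computable G ->
     (forall e, [/\ connected (G e), locally_finite (G e) &
                    number_of_ends (G e) 1]) ->
     Sigma2inv [set e | one_way_eulerian (G e)]) /\
  (forall W : set nat,
     Sigma2inv W ->
     exists G : nat -> multigraph,
       [/\ uniformly_highly_computable G,
           forall e, [/\ connected (G e), locally_finite (G e) &
                         number_of_ends (G e) 1] &
           W = [set e | one_way_eulerian (G e)]]) /\
  (exists G : nat -> multigraph,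
     [/\ uniformly_highly_computable G,
         forall e, [/\ connected (G e), locally_finite (G e) &
                       number_of_ends (G e) 1] &
         Sigma2inv_complete [set e | one_way_eulerian (G e)]]).
Proof.
split; first exact: Sigma2inv_eulerian.
split; first exact: Sigma2inv_realized.
have [G [cG HG KE]] := Sigma2inv_realized Sigma2inv_universal.
exists G; split=> //; rewrite -KE.
split; [exact: Sigma2inv_universal|exact: universal_Sigma2inv_hard].
Qed.
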